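(* Let $\ell$ be an odd prime with $\ell\mid q-\eta$, let $m\ge1$, $\alpha,\gamma\ge0$ and let $\mathbf c\ne\mathbf 0$. Suppose that the basic subgroup $\tilde R_{m,\alpha,\gamma,\mathbf c}$ is a radical $\ell$-subgroup of $\tilde G_{m,\alpha,\gamma,\mathbf c}=\mathrm{GL}_{m\ell^{\alpha+\gamma+|\mathbf c|}}(\eta q)$, and that we are not in the case: $\ell=3$, $a=1$, $\nu(m)=\alpha=\gamma=0$ and $\mathbf c=(1)$. Then $\tilde R_{m,\alpha,\gamma,\mathbf c}$ is special with respect to $G_{m,\alpha,\gamma,\mathbf c}=\mathrm{SL}_{m\ell^{\alpha+\gamma+|\mathbf c|}}(\eta q)$.
   Context: Let $p$ be a prime, $q$ a power of $p$, $\eta\in\{1,-1\}$, $\overline{\mathbb F}$ an algebraic closure of $\mathbb F_q$. On $\mathrm{GL}_N(\overline{\mathbb F})$ let $F$ be $A\mapsto A^{(q)}$ (entrywise $q$-th powers) if $\eta=1$, and $A\mapsto((A^{(q)})^{-1})^t$ if $\eta=-1$. $\mathrm{GL}_N((\eta q)^k)$ denotes the fixed points of $F^k$; so $\mathrm{GL}_N(\eta q)$ is $\mathrm{GL}_N(q)$ or $\mathrm{GU}_N(q)$, and $\mathrm{SL}_N(\eta q)$ is its subgroup of determinant 1. $\ell\neq p$ is an odd prime with $\ell\mid q-\eta$, $\nu$ is the $\ell$-adic valuation, $a=\nu(q-\eta)$. Tensor product of matrices: $A\otimes B=(b_{ij}A)$. Basic subgroups: fix $\zeta\in\overline{\mathbb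 F}^\times$ of order $\ell^{a+\alpha}$, $\zeta_\ell=\zeta^{\ell^{a+\alpha-1}}$, $x=\mathrm{diag}(1,\zeta_\ell,\dots,\zeta_\ell^{\ell-1})$, $y=\begin{pmatrix}0&1\\ I_{\ell-1}&0\end{pmatrix}$; for $1\le j\le\gamma$, $x_j$, $y_j$ are the $\gamma$-fold tensor products with $x$, resp. $y$, in position $j$ and $I_\ell$ elsewhere. Let $R^0=\langle \zeta I_{m\ell^\gamma},\,I_m\otimes x_j,\,I_m\otimes y_j: 1\le j\le\gamma\rangle\le\mathrm{GL}_{m\ell^\gamma}((\eta q)^{\ell^\alpha})$. Put $k=\ell^\alpha$, choose $g_1\in\mathrm{SL}_k(\overline{\mathbb F})$ with $g_1^{-1}F(g_1)=\begin{pmatrix}0&1\\ I_{k-1}&0\end{pmatrix}$ (the matrix $(1)$ if $k=1$), $g=I_{m\ell^\gamma}\otimes g_1$, and $\tilde R_{m,\alpha,\gamma}=\{g\,\mathrm{diag}(A,F(A),\dots,F^{k-1}(A))\,g^{-1}:A\in R^0\}\le\mathrm{GL}_{m\ell^{\alpha+\gamma}}(\eta q)$. For a finite sequence $\mathbf c=(c_1,\dots,c_r)$ of positive integers (the empty sequence is $\mathbf 0$), $|\mathbf c|=c_1+\cdots+c_r$, $A_{\mathbf c}=A_{c_1}\wr\cdots\wr A_{c_r}\le\mathfrak S_{\ell^{|\mathbf c|}}$, where $A_c$ is elementary abelian of order $\ell^c$ in its regular permutation representation, and $\tilde R_{m,\alpha,\gamma,\mathbf c}=\tilde R_{m,\alpha,\gamma}\wr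 A_{\mathbf c}\le\mathrm{GL}_{m\ell^{\alpha+\gamma+|\mathbf c|}}(\eta q)$ (monomial block matrices). An $\ell$-subgroup $\tilde R$ of a finite group $\tilde H$ is radical if $\tilde R=\mathrm O_\ell(N_{\tilde H}(\tilde R))$. If $H\unlhd\tilde H$, a radical $\ell$-subgroup $\tilde R$ of $\tilde H$ is special with respect to $H$ if $\tilde R=\mathrm O_\ell(N_{\tilde H}(\tilde R\cap H))$. *)

(* Defs.v *)
From HB Require Import structures.
From mathcomp Require Import all_boot all_order all_algebra all_fingroup.
From mathcomp Require Import all_solvable all_field.
From mathcomp Require Import mxtens zify.

Set Implicit Arguments.
Unset Strict Implicit.
Unset Printing Implicit Defensive.

Import GRing.Theory.
Local Open Scope ring_scope.

Section Steinberg.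

Variables (K : fieldType) (eta : int) (q : nat).

Definition frobmx (n : nat) (A : 'M[K]_n) : 'M[K]_n :=
  map_mx (fun x => x ^+ q) A.

(* eta is meant to be 1 or -1; any value other than 1 is treated as -1. *)
Definition steinberg (n : nat) (A : 'M[K]_n) : 'M[K]_n :=
  if eta == 1 then frobmx A else (invmx (frobmx A))^T.

Hypothesis qP : [pchar K].-nat q.

Let frobB : zmod_morphism (fun x : K => x ^+ q).
Proof. by move=> x y; rewrite exprDn_pchar // exprNn_pchar. Qed.

Let frobM : monoid_morphism (fun x : K => x ^+ q).
Proof. by split=> [|x y]; rewrite ?expr1n ?exprMn. Qed.

Let frob (x : K) : K := x ^+ q.
HB.instance Definition _ := GRing.isZmodMorphism.Build K K frob frobB.
HB.instance Definition _ := GRing.isMonoidMorphism.Build K K frob frobM.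

Lemma frobmx_unit n (A : 'M[K]_n) : (frobmx A \in unitmx) = (A \in unitmx).
Proof. exact: (map_unitmx frob A). Qed.

Lemma frobmxM n (A B : 'M[K]_n) : frobmx (A *m B) = frobmx A *m frobmx B.
Proof. exact: (map_mxM frob A B). Qed.

Lemma frobmxV n (A : 'M[K]_n) : frobmx (invmx A) = invmx (frobmx A).
Proof. exact: (map_invmx frob A). Qed.

Lemma frobmx1 n : frobmx (1%:M : 'M[K]_n) = 1%:M.
Proof. exact: (map_mx1 frob n). Qed.

Lemma steinberg_unit n (A : 'M[K]_n) : A \in unitmx -> steinberg A \in unitmx.
Proof.
by rewrite /steinberg; case: ifP; rewrite ?unitmx_tr ?unitmx_inv frobmx_unit.
Qed.

Lemma steinbergM n (A B : 'M[K]_n) : A \in unitmx -> B \in unitmx ->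
  steinberg (A *m B) = steinberg A *m steinberg B.
Proof.
move=> uA uB; rewrite /steinberg frobmxM; case: ifP => // _.
rewrite -trmx_mul; congr (_^T).
have [uA' uB'] : frobmx A \in unitmx /\ frobmx B \in unitmx.
  by rewrite !frobmx_unit.
have uAB : frobmx A *m frobmx B \in unitmx by rewrite unitmx_mul uA' uB'.
apply: (can_inj (mulKmx uAB)).
by rewrite mulmxV // -mulmxA (mulmxA (frobmx B)) mulmxV // mul1mx mulmxV.
Qed.

Lemma steinberg1 n : steinberg (1%:M : 'M[K]_n) = 1%:M.
Proof. by rewrite /steinberg frobmx1 invmx1 trmx1 if_same. Qed.

Lemma steinberg_sqr n (A : 'M[K]_n) :
  steinberg (steinberg A) = frobmx (frobmx A).
Proof.
rewrite /steinberg; case: (eta == 1) => //.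
have -> : frobmx (invmx (frobmx A))^T = (invmx (frobmx (frobmx A)))^T.
  by rewrite -(frobmxV (frobmx A)) /frobmx map_trmx.
by rewrite -trmx_inv trmxK invmxK.
Qed.

Lemma iter_steinberg_unit k n (A : 'M[K]_n) :
  A \in unitmx -> iter k (@steinberg n) A \in unitmx.
Proof. by move=> uA; elim: k => //= k; apply: steinberg_unit. Qed.

Lemma iter_steinbergM k n (A B : 'M[K]_n) : A \in unitmx -> B \in unitmx ->
  iter k (@steinberg n) (A *m B)
    = iter k (@steinberg n) A *m iter k (@steinberg n) B.
Proof.
by move=> uA uB; elim: k => //= k ->; rewrite steinbergM ?iter_steinberg_unit.
Qed.

Lemma iter_steinberg1 k n : iter k (@steinberg n) 1%:M = 1%:M.
Proof. by elim: k => //= k ->; apply: steinberg1. Qed.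

Lemma iter_steinberg_double k n (A : 'M[K]_n) i j :
  iter k.*2 (@steinberg n) A i j = A i j ^+ (q ^ k.*2).
Proof.
elim: k => [|k IHk] /=; first by rewrite expr1.
by rewrite steinberg_sqr !mxE IHk -!exprM !expnSr mulnA.
Qed.

End Steinberg.

(* The group GL_n((eta q)^k) of fixed points of F^k on GL_n(K), where K is a
   closed field given with an embedding iota of a field Fq of q elements (iota
   is a parameter because the group law rests on it).  The exponent k.-1.+1 is k
   for k > 0, and makes the type finite for k = 0 too. *)
Record glFix (Fq : finFieldType) (K : closedFieldType)
    (iota : {rmorphism Fq -> K}) (eta : int) (k n : nat) := GLFix {
  glval :> 'M[K]_n;
  _ : (glval \in unitmx) && (iter k.-1.+1 (@steinberg K eta #|Fq| n) glval == glval)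
}.

Section FixedPoints.

Variables (Fq : finFieldType) (K : closedFieldType) (iota : {rmorphism Fq -> K}).
Variables (eta : int) (k n : nat).

Local Notation q := #|Fq|.
Local Notation F := (@steinberg K eta q n).
Local Notation glFix := (glFix iota eta k n).

HB.instance Definition _ := [isSub for @glval Fq K iota eta k n].
HB.instance Definition _ := [Choice of glFix by <:].

Fact pchar_nat_q : [pchar K].-nat q.
Proof.
have [p p_pr charFp] := finPcharP Fq.
have charKp : p \in [pchar K].
  by rewrite inE p_pr /= -(rmorph_nat iota) (pcharf0 charFp) rmorph0.
rewrite (eq_pnat _ (pcharf_eq charKp)).
have -> : q = (p ^ logn p q)%N := card_pprimeChar charFp.
by rewrite pnatX pnat_id.
Qed.

Let N := (q ^ k.-1.+1.*2)%N.

Let N_gt1 : (1 < N)%N.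
Proof. by rewrite -(expn0 q) ltn_exp2l // finNzRing_gt1. Qed.

Let roots : seq K := sval (closed_field_poly_normal ('X^N - 'X)).

Fact mem_roots (A : glFix) i j : A i j \in roots.
Proof.
rewrite /roots; case: (closed_field_poly_normal _) => r /= Dr.
have nz : lead_coef ('X^N - 'X) != 0 :> K.
  rewrite lead_coef_eq0 -size_poly_eq0 size_polyDl ?size_polyXn //.
  by rewrite size_polyN size_polyX ltnS.
case: A => A /= /andP[uA /eqP fixA].
have : root (lead_coef ('X^N - 'X) *: \prod_(z <- r) ('X - z%:P)) (A i j).
  rewrite -Dr rootE !hornerE subr_eq0 /N.
  rewrite -(iter_steinberg_double eta pchar_nat_q) -addnn iterD.
  by rewrite !(fixA : iter k.-1.+1 F A = A) eqxx.
by rewrite rootZ // root_prod_XsubC.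
Qed.

Let code (A : glFix) : {ffun 'I_n * 'I_n -> 'I_(size roots).+1} :=
  [ffun ij => inord (index (A ij.1 ij.2) roots)].
Let decode (f : {ffun 'I_n * 'I_n -> 'I_(size roots).+1}) : option glFix :=
  insub (\matrix_(i, j) nth 0 roots (f (i, j))).

Fact codeK : pcancel code decode.
Proof.
move=> A; rewrite /decode -[RHS]valK; congr (insub _); apply/matrixP => i j.
by rewrite mxE ffunE inordK /= ?ltnS ?index_size // nth_index ?mem_roots.
Qed.

HB.instance Definition _ := isCountable.Build glFix (pcan_pickleK codeK).
HB.instance Definition _ := isFinite.Build glFix (pcan_enumP codeK).

Fact glFix_mulP (A B : glFix) :
  (A *m B \in unitmx) && (iter k.-1.+1 F (A *m B) == A *m B).
Proof.
case: A B => [A /= /andP[uA /eqP fA]] [B /= /andP[uB /eqP fB]].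
have := iter_steinbergM eta pchar_nat_q k.-1.+1 uA uB => /= ->.
by rewrite unitmx_mul uA uB fA fB eqxx.
Qed.

Fact glFix_oneP :
  ((1%:M : 'M[K]_n) \in unitmx) && (iter k.-1.+1 F 1%:M == 1%:M).
Proof.
by rewrite unitmx1; apply/eqP/(iter_steinberg1 eta pchar_nat_q k.-1.+1).
Qed.

Fact glFix_invP (A : glFix) :
  (invmx A \in unitmx) && (iter k.-1.+1 F (invmx A) == invmx A).
Proof.
case: A => [A /= /andP[uA /eqP fA]].
rewrite unitmx_inv uA /=; apply/eqP/(can_inj (mulKmx uA)).
rewrite mulmxV // -{1}fA.
have := iter_steinbergM eta pchar_nat_q k.-1.+1 uA.
move=> /(_ (invmx A)); rewrite unitmx_inv => /(_ uA) /= <-.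
by rewrite mulmxV //; apply: (iter_steinberg1 eta pchar_nat_q k.-1.+1).
Qed.

Let mul (A B : glFix) : glFix := GLFix iota (glFix_mulP A B).
Let one : glFix := GLFix iota glFix_oneP.
Let inv (A : glFix) : glFix := GLFix iota (glFix_invP A).

Let mulA : associative mul.
Proof. by move=> A B C; apply: val_inj; apply: mulmxA. Qed.
Let mul1 : left_id one mul.
Proof. by move=> A; apply: val_inj; apply: mul1mx. Qed.
Let mulV : left_inverse one inv mul.
Proof.
move=> A; apply: val_inj; apply: mulVmx.
by case: A => A /= /andP[].
Qed.

HB.instance Definition _ := Finite_isGroup.Build glFix mulA mul1 mulV.

End FixedPoints.

Lemma glFix_unit Fq K iota eta k n (A : @glFix Fq K iota eta k n) :
  (A : 'M_n) \in unitmx.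
Proof. by case: A => A /= /andP[]. Qed.

Section SpecialLinear.

Variables (Fq : finFieldType) (K : closedFieldType) (iota : {rmorphism Fq -> K}).
Variables (eta : int) (n : nat).

Local Notation GL := (glFix iota eta 1 n).

Definition slFix : {set GL} := [set A : GL | \det (A : 'M[K]_n) == 1].

Fact slFix_group_set : group_set slFix.
Proof.
apply/group_setP; split=> [|A B]; first by rewrite inE det1.
by rewrite !inE det_mulmx => /eqP -> /eqP ->; rewrite mulr1.
Qed.

Canonical slFix_group := Group slFix_group_set.

Lemma slFix_normal : (slFix <| [set: GL])%g.
Proof.
apply/normalP; split=> [|B _]; first exact: subsetT.
apply/setP => A; rewrite mem_conjg !inE.
rewrite -[glval _]/(invmx (invmx B) *m (A *m invmx B)).
rewrite !det_mulmx mulrCA -det_mulmx mulVmx ?det1 ?mulr1 //.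
by rewrite unitmx_inv glFix_unit.
Qed.

End SpecialLinear.

Section Radical.

Variables (gT : finGroupType) (l : nat).

Definition radical_lsub (G R : {set gT}) : Prop :=
  [/\ R \subset G, (l.-group R)%g & R = 'O_l('N_G(R))%g].

Definition special_lsub (G H R : {set gT}) : Prop :=
  radical_lsub G R /\ R = 'O_l('N_G(R :&: H))%g.

End Radical.

(* A (x) B = (b_ij A): the right-hand factor indexes the blocks, so this is
   tensmx with its arguments exchanged. *)
Definition tens (R : pzRingType) m n p q (A : 'M[R]_(m, n)) (B : 'M[R]_(p, q)) :
  'M[R]_(p * m, q * n) := tensmx B A.

(* l ^ g, defined so that powdim l g.+1 is convertible to l * powdim l g. *)
Fixpoint powdim (l g : nat) : nat :=
  if g is g'.+1 then (l * powdim l g')%N else 1%N.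

(* M 0 (x) M 1 (x) ... (x) M (g - 1) *)
Fixpoint tensprod (R : pzRingType) l (M : nat -> 'M[R]_l) (g : nat) :
    'M[R]_(powdim l g) :=
  if g is g'.+1 then tens (tensprod M g') (M g') else 1%:M.

(* The block matrix (0 1; I_(n-1) 0), which is (1) for n = 1. *)
Definition cyclemx (R : pzRingType) n : 'M[R]_n :=
  \matrix_(i, j) (i == j.+1 %% n :> nat)%N%:R.

(* The block matrix with block f i in position (s i, i) and 0 elsewhere. *)
Definition monomial_block (R : pzRingType) d n (s : 'S_d)
    (f : 'I_d -> 'M[R]_n) : 'M[R]_(d * n) :=
  \sum_i tens (f i) (delta_mx (s i) i).

(* The wreath product A wr B in its imprimitive action on b * a points,
   the points of the i-th block being the mxtens_index (i, j). *)
Definition permwr a b (A : {set 'S_a}) (B : {set 'S_b}) : {set 'S_(b * a)} :=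
  [set s : 'S_(b * a) | [exists t in B, [exists h : {ffun 'I_b -> 'S_a},
     [forall i, h i \in A] &&
     [forall i, forall j,
        s (mxtens_index (i, j)) == mxtens_index (t i, h i j)]]]].

(* l ^ (c_1 + ... + c_r), see seqdimE. *)
Fixpoint seqdim (l : nat) (c : seq nat) : nat :=
  if c is c1 :: c' then (seqdim l c' * l ^ c1)%N else 1%N.

(* For c = [:: c_1; ...; c_r], this is A_(c_1) wr (A_(c_2) wr (... wr A_(c_r))),
   which is the left-associated product since mxtens_index is lexicographic. *)
Fixpoint Aseq l (A : forall c, {group 'S_(l ^ c)}) (c : seq nat) :
    {set 'S_(seqdim l c)} :=
  if c is c1 :: c' then permwr (A c1) (Aseq A c') else [set 1%g].

Definition regular_elementary_abelian l c (A : {group 'S_(l ^ c)}) : Prop :=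
  [/\ (l.-abelem A)%g, #|A| = (l ^ c)%N,
      [transitive A, on [set: 'I_(l ^ c)] | 'P]%g
    & forall i : 'I_(l ^ c), ('C_A[i | 'P] = 1)%g].

Section BasicSubgroups.

Variables (Fq : finFieldType) (K : closedFieldType) (iota : {rmorphism Fq -> K}).
Variables (eta : int) (l : nat).

Local Notation q := #|Fq|.

(* the l-adic valuation a of q - eta *)
Definition aval : nat := logn l `|q%:Z - eta|%N.

Variables (m alpha gamma : nat) (zeta : K) (g1 : 'M[K]_(l ^ alpha)).

Definition zetal : K := zeta ^+ (l ^ (aval + alpha).-1).

Definition xmx : 'M[K]_l := diag_mx (\row_i zetal ^+ i).
Definition ymx : 'M[K]_l := cyclemx K l.

(* B in position j of a gamma-fold tensor product, the other factors being I_l *)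
Definition factor (B : 'M[K]_l) (j : nat) : 'M[K]_(powdim l gamma) :=
  tensprod (fun i => if i == j then B else 1%:M) gamma.

(* The three kinds of generators are matrices over K; they are fixed by F^k for
   k = l ^ alpha because zeta^((eta q)^k - 1) = 1 when l is odd and divides
   q - eta. *)
Definition R0 : {group glFix iota eta (l ^ alpha) (powdim l gamma * m)} :=
  <<[set A : glFix iota eta (l ^ alpha) (powdim l gamma * m) |
      [|| glval A == zeta%:M,
          [exists j : 'I_gamma, glval A == tens (1%:M : 'M_m) (factor xmx j)]
        | [exists j : 'I_gamma, glval A == tens (1%:M : 'M_m) (factor ymx j)]]]>>%G.

(* m * l ^ (alpha + gamma) *)
Definition basicdim0 : nat := (l ^ alpha * (powdim l gamma * m))%N.

(* diag (A, F(A), ..., F^(k-1)(A)) for k = l ^ alpha *)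
Definition twisted_diag (A : 'M[K]_(powdim l gamma * m)) : 'M[K]_basicdim0 :=
  monomial_block 1%g
    (fun i : 'I_(l ^ alpha) => iter i (@steinberg K eta q _) A).

(* g diag (A, F(A), ...) g^-1 is fixed by F when g1^-1 F(g1) = cyclemx. *)
Definition basic0 : {set glFix iota eta 1 basicdim0} :=
  let g : 'M[K]_basicdim0 := tens (1%:M : 'M_(powdim l gamma * m)) g1 in
  [set B : glFix iota eta 1 basicdim0 |
    [exists A in R0, glval B == g *m twisted_diag (glval A) *m invmx g]].

Variables (A : forall c, {group 'S_(l ^ c)}) (c : seq nat).

(* m * l ^ (alpha + gamma + |c|), see basicdimE. *)
Definition basicdim : nat := (seqdim l c * basicdim0)%N.

Definition basic : {set glFix iota eta 1 basicdim} :=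
  [set B : glFix iota eta 1 basicdim |
    [exists s in Aseq A c,
      [exists f : {ffun 'I_(seqdim l c) -> glFix iota eta 1 basicdim0},
        [forall i, f i \in basic0] &&
        (glval B == monomial_block s (fun i => glval (f i)))]]].

Lemma powdimE g : powdim l g = (l ^ g)%N.
Proof. by elim: g => //= g ->; rewrite expnS. Qed.

Lemma seqdimE s : seqdim l s = (l ^ sumn s)%N.
Proof. by elim: s => //= c1 s ->; rewrite -expnD addnC. Qed.

Lemma basicdimE : basicdim = (m * l ^ (alpha + gamma + sumn c))%N.
Proof. by rewrite /basicdim /basicdim0 seqdimE powdimE !expnD; lia. Qed.

End BasicSubgroups.

(* Main.v *)
Require Import Defs.
From HB Require Import structures.
From mathcomp Require Import all_boot all_order all_algebra all_fingroup.
From mathcomp Require Import all_solvable all_field.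
From mathcomp Require Import mxtens zify ring.

Set Implicit Arguments.
Unset Strict Implicit.
Unset Printing Implicit Defensive.

Import GRing.Theory.
Local Open Scope ring_scope.

(** Write [R] for the basic subgroup and [S] for its intersection with the
    special linear group.  As the latter is normal, [N(R)] is contained in
    [N(S)]; once [N(S)] is contained in [N(R)] the two normalizers coincide, and
    being special is the same as being radical.  So the point is that whatever
    normalizes [S] normalizes [R] ([norm_SL_wreath]).

    The group [R] consists of the monomial block matrices with permutation part
    in a permutation group [C] of degree [n] and blocks in a group [X].  Here [X]
    is nilpotent of class at most two, its centre is cyclic, generated by some
    [z] of order [l ^ (a + alpha)], and [X] is generated by [z] and by elements
    of determinant one: clock and shift matrices of odd size have determinant
    one.  Since [R] is an [l]-group with [l] odd, its block permutation matrices
    have determinant one as well.  Hence [R] is generated by [S] and a single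
    matrix [w0] which is [z] in one block and [1] in the others ([R_decomp]), and
    it is enough that [w0 ^ g] lies in [R] for each [g] normalizing [S].

    First, the diagonal matrices of [S] with entries in [<[z]>] are recognized
    inside the abstract group [S].  Let [Q] be the set of those elements of [S]
    which commute with all their [S]-conjugates.  Testing an element with
    permutation part [s] against matrices with entries [z] in one block and
    [z^-1] in another gives [s = 1] ([Q_diag]), unless [n = 3] and [z] has
    order [3].  As [Q] contains those test matrices, and also the
    elements [e] of [X] of determinant one put in one block, the centralizer of
    [Q] in [S] is the group of diagonal matrices of determinant one with entries
    in [<[z]>] ([cent_Q], [zdiag_cent]).  So conjugation by [g] preserves it.

    Secondly, [w0] is recovered from that group by linear algebra.  If [t] has
    entries [z], [z^-1] and [1] otherwise, a suitable power of [t] has the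
    scalar entries [om], [om^-1] and [1], where [om] is a primitive [l]-th root
    of unity; these three scalars are distinct, so a polynomial in [t] equals
    [w0] ([blockPoly]).  Applying the polynomial to [t ^ g], whose entries are
    powers of [z], shows that [w0 ^ g] is block diagonal, with entries which are
    polynomials in [z].  They are fixed by [F] and have order dividing that of
    [z], and such matrices are powers of [z] ([scalar_blocks_fixed]): up to
    conjugation a polynomial in [z] is diagonal with scalar blocks, and [F] moves
    each block to the next, so that the first block determines the others.

    When [n = 3] and [z] has order [3], we have [l = 3], [a = 1], [alpha = 0] and
    [c] is the sequence with single term [1].  Outside the excluded case [3]
    divides [m] or [gamma] is positive; then [z] has determinant one and [R = S]
    ([wreath_sub_SL], [det_blockz]). *)

(** * Monomial block matrices *)

Section MonomialBlock.

Variables (R : comNzRingType) (d n : nat).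
Implicit Types (s t : 'S_d) (f h : 'I_d -> 'M[R]_n).

Lemma monomial_blockE s f i a j b :
  monomial_block s f (mxtens_index (i, a)) (mxtens_index (j, b))
    = if i == s j then f j a b else 0.
Proof.
rewrite /monomial_block summxE (bigD1 j) //= tensmxE mxE eqxx andbT big1.
  by case: eqP => _; rewrite ?mul1r ?mul0r addr0.
by move=> k nkj; rewrite tensmxE mxE (eq_sym j) (negPf nkj) andbF mul0r.
Qed.

Lemma eq_monomial_block s f h : f =1 h -> monomial_block s f = monomial_block s h.
Proof. by move=> efh; apply: eq_bigr => i _; rewrite efh. Qed.

Lemma monomial_blockM s t f h :
  monomial_block s f *m monomial_block t h
    = monomial_block (t * s)%g (fun i => f (t i) *m h i).
Proof.
rewrite /monomial_block mulmx_sumr; apply: eq_bigr => j _.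
rewrite mulmx_suml (bigD1 (t j)) //= tensmx_mul mul_delta_mx permM big1 ?addr0 //.
by move=> i nij; rewrite tensmx_mul mul_delta_mx_0 // tens0mx.
Qed.

Lemma monomial_block1 : monomial_block 1 (fun=> 1%:M) = 1%:M :> 'M[R]_(d * n).
Proof.
apply/matrixP => x y; case: (mxtens_indexP x) => i a.
case: (mxtens_indexP y) => j b; rewrite monomial_blockE perm1 !mxE.
by rewrite (inj_eq (can_inj (@mxtens_indexK d n))) xpair_eqE; case: eqP.
Qed.

Lemma monomial_block_lin s (c : R) f h :
  monomial_block s (fun i => c *: f i + h i)
    = c *: monomial_block s f + monomial_block s h.
Proof.
apply/matrixP => x y; case: (mxtens_indexP x) => i a.
case: (mxtens_indexP y) => j b; rewrite !(monomial_blockE, mxE).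
by case: eqP => //; rewrite mulr0 addr0.
Qed.

Lemma trmx_monomial_block s f :
  (monomial_block s f)^T = monomial_block s^-1 (fun i => (f ((s^-1)%g i))^T).
Proof.
apply/matrixP => x y; case: (mxtens_indexP x) => i a.
case: (mxtens_indexP y) => j b; rewrite mxE !(monomial_blockE, mxE).
have [->|nj] := eqVneq j (s i); first by rewrite permK eqxx.
by case: eqP => // def_i; rewrite def_i permKV eqxx in nj.
Qed.

Lemma monomial_block_injr s f h :
  monomial_block s f = monomial_block s h -> f =1 h.
Proof.
move=> /matrixP e j; apply/matrixP => a b.
have := e (mxtens_index (s j, a)) (mxtens_index (j, b)).
by rewrite !monomial_blockE eqxx.
Qed.

Lemma monomial_block_inj s t f h (f_neq0 : forall i, f i != 0) :
  monomial_block s f = monomial_block t h -> s = t /\ f =1 h.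
Proof.
move=> e; suff st : s = t by split=> //; apply: (@monomial_block_injr s); rewrite e st.
apply/permP => j; apply/eqP; apply: contraNT (f_neq0 j) => nst.
apply/eqP/matrixP => a b; rewrite mxE.
have /matrixP/(_ (mxtens_index (s j, a)) (mxtens_index (j, b))) := e.
by rewrite !monomial_blockE eqxx (negPf nst).
Qed.

End MonomialBlock.

Lemma det_monomial_block1 (R : comNzRingType) d n (f : 'I_d -> 'M[R]_n) :
  \det (monomial_block 1 f) = \prod_i \det (f i).
Proof.
elim: d f => [|d IHd] f; first by rewrite big_ord0 det_mx00.
have -> : monomial_block 1 f
    = (block_mx (f ord0) 0 0 (monomial_block 1 (fun i => f (lift ord0 i)))
      : 'M_(n + d * n)).
  apply/matrixP => x y; case: (mxtens_indexP x) => i a.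
  case: (mxtens_indexP y) => j b; rewrite monomial_blockE perm1.
  have Ei (k : 'I_d.+1) (u : 'I_n) : mxtens_index (k, u) =
      match unlift ord0 k with
      | Some k' => rshift n (mxtens_index (k', u)) | None => lshift (d * n) u end.
    apply: val_inj => /=; case: unliftP => [k'|] -> //=.
    by rewrite /bump leq0n /= mulSn addnA.
  rewrite 2!Ei; case: unliftP => [i'|] ->; case: unliftP => [j'|] ->;
    rewrite ?block_mxEul ?block_mxEur ?block_mxEdl ?block_mxEdr ?mxE ?eqxx //.
  by rewrite monomial_blockE perm1 (inj_eq (@lift_inj _ ord0)).
by rewrite det_ublock IHd big_ord_recl.
Qed.

(** Block permutation matrices are orthogonal. *)
Lemma det_monomial_block_perm_sqr (R : comNzRingType) d n (s : 'S_d) :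
  \det (monomial_block s (fun=> 1%:M) : 'M[R]_(d * n)) ^+ 2 = 1.
Proof.
rewrite expr2 -{1}det_tr -det_mulmx trmx_monomial_block monomial_blockM mulgV.
rewrite (@eq_monomial_block _ _ _ _ _ (fun=> 1%:M)) ?monomial_block1 ?det1 // => i.
by rewrite trmx1 mulmx1.
Qed.

(** * Monomial block matrices in the finite groups *)

Lemma unitmx_neq0 (K : fieldType) n (A : 'M[K]_n) :
  (0 < n)%N -> A \in unitmx -> A != 0.
Proof.
by case: n A => // n A _; apply: contraTneq => ->; rewrite unitmxE det0 unitr0.
Qed.

Section SteinbergBlock.

Variables (K : fieldType) (eta : int) (q d n : nat).
Implicit Types (s : 'S_d) (f : 'I_d -> 'M[K]_n).
Local Notation F := (steinberg eta q).

Lemma monomial_block_unit s f :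
  (forall i, f i \in unitmx) -> monomial_block s f \in unitmx.
Proof.
move=> uf; pose h i := invmx (f ((s^-1)%g i)).
have /mulmx1_unit[//] : monomial_block s f *m monomial_block (s^-1)%g h = 1%:M.
rewrite monomial_blockM mulVg -monomial_block1; apply: eq_monomial_block => i.
exact: mulmxV.
Qed.

Lemma invmx_monomial_block s f : (forall i, f i \in unitmx) ->
  invmx (monomial_block s f)
    = monomial_block (s^-1)%g (fun i => invmx (f ((s^-1)%g i))).
Proof.
move=> uf; apply: (can_inj (mulKmx (monomial_block_unit s uf))).
rewrite mulmxV ?monomial_block_unit // monomial_blockM mulVg -monomial_block1.
by apply: eq_monomial_block => i; rewrite mulmxV.
Qed.

Lemma steinberg_monomial_block s f (q_gt0 : (0 < q)%N) (qP : [pchar K].-nat q) :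
    (forall i, f i \in unitmx) ->
  F (monomial_block s f) = monomial_block s (fun i => F (f i)).
Proof.
move=> uf; have Dfr : frobmx q (monomial_block s f)
    = monomial_block s (fun i => frobmx q (f i)).
  apply/matrixP => x y; case: (mxtens_indexP x) => i a.
  case: (mxtens_indexP y) => j b; rewrite mxE !monomial_blockE mxE.
  by case: ifP => // _; rewrite expr0n eqn0Ngt q_gt0.
have ufr i : frobmx q (f i) \in unitmx by rewrite frobmx_unit.
rewrite /steinberg; case: ifP => // _; rewrite Dfr invmx_monomial_block //.
rewrite trmx_monomial_block invgK; apply: eq_monomial_block => i.
by rewrite permK.
Qed.

End SteinbergBlock.

Section Mono.

Variables (Fq : finFieldType) (K : closedFieldType) (iota : {rmorphism Fq -> K}).
Variables (eta : int) (d n : nat).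
Hypothesis d_gt0 : (0 < d)%N.

Local Notation q := #|Fq|.
Local Notation G := (glFix iota eta 1 d).
Local Notation W := (glFix iota eta 1 (n * d)).
Implicit Types (s t : 'S_n) (f h : 'I_n -> G) (w : W).

Lemma card_Fq_gt0 : (0 < q)%N. Proof. exact: ltnW (finNzRing_gt1 Fq). Qed.

Lemma glFix_fixed (N : nat) (x : glFix iota eta 1 N) :
  steinberg eta q (glval x) = glval x.
Proof. by case: x => x /= /andP[_ /eqP]. Qed.

Lemma glvalM k N (x y : glFix iota eta k N) : glval (x * y)%g = glval x *m glval y.
Proof. by []. Qed.

Lemma glval1 k N : glval (1%g : glFix iota eta k N) = 1%:M.
Proof. by []. Qed.

Lemma glvalV k N (x : glFix iota eta k N) : glval (x^-1)%g = invmx (glval x).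
Proof. by []. Qed.

Fact monoGL_subproof s f :
  (monomial_block s (fun i => glval (f i)) \in unitmx)
  && (iter 1.-1.+1 (steinberg eta q (n := n * d))
        (monomial_block s (fun i => glval (f i)))
      == monomial_block s (fun i => glval (f i))).
Proof.
rewrite monomial_block_unit => [|i]; last exact: glFix_unit.
rewrite /= steinberg_monomial_block ?card_Fq_gt0 ?(pchar_nat_q iota) // => [|i].
  by apply/eqP/eq_monomial_block => i; apply: glFix_fixed.
exact: glFix_unit.
Qed.

(** [monomial_block] as an element of the fixed point group of [F], which acts
    on each block separately. *)
Definition monoGL s f : W := GLFix iota (monoGL_subproof s f).

Lemma eq_monoGL s f h : f =1 h -> monoGL s f = monoGL s h.
Proof.
by move=> efh; apply: val_inj; apply: eq_monomial_block => i; rewrite efh.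
Qed.

Lemma monoGLM s t f h :
  (monoGL s f * monoGL t h)%g = monoGL (t * s) (fun i => f (t i) * h i)%g.
Proof. by apply: val_inj; apply: monomial_blockM. Qed.

Lemma monoGL1 : monoGL 1 (fun=> 1%g) = 1%g.
Proof. by apply: val_inj; apply: monomial_block1. Qed.

Lemma monoGL_inj s t f h : monoGL s f = monoGL t h -> s = t /\ f =1 h.
Proof.
move=> /(congr1 val) /monomial_block_inj[i|-> fh].
  exact: unitmx_neq0 d_gt0 (glFix_unit (f i)).
by split=> // i; apply: val_inj; apply: fh.
Qed.

Lemma monoGL1M f h : (monoGL 1 f * monoGL 1 h)%g = monoGL 1 (fun i => f i * h i)%g.
Proof. by rewrite monoGLM mulg1; apply: eq_monoGL => i; rewrite perm1. Qed.

Lemma monoGL1X f r : (monoGL 1 f ^+ r)%g = monoGL 1 (fun i => f i ^+ r)%g.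
Proof.
elim: r => [|r IHr]; first by rewrite expg0 -monoGL1; apply: eq_monoGL => i.
by rewrite expgS IHr monoGL1M; apply: eq_monoGL => i; rewrite expgS.
Qed.

Lemma monoGL1J s f h : (monoGL 1 h ^ monoGL s f)%g = monoGL 1 (fun i => h (s i) ^ f i)%g.
Proof.
rewrite conjgE; apply: (mulgI (monoGL s f)); rewrite mulKVg !monoGLM mulg1 mul1g.
by apply: eq_monoGL => i; rewrite perm1 conjgE mulKVg.
Qed.

Lemma monoGLJ1 s f h :
  (monoGL s f ^ monoGL 1 h)%g = monoGL s (fun i => (h (s i))^-1 * f i * h i)%g.
Proof.
rewrite conjgE; apply: (mulgI (monoGL 1 h)); rewrite mulKVg !monoGLM mulg1 mul1g.
by apply: eq_monoGL => i; rewrite perm1 -mulgA mulKVg.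
Qed.

Lemma monoGLE s f : monoGL s f = (monoGL s (fun=> 1%g) * monoGL 1 f)%g.
Proof. by rewrite monoGLM mul1g; apply: eq_monoGL => i; rewrite mul1g. Qed.

Lemma det_monoGL1 f : \det (glval (monoGL 1 f)) = \prod_i \det (glval (f i)).
Proof. exact: det_monomial_block1. Qed.

(** Invertibility and invariance under [F] can both be read off block by block,
    so the blocks of a block diagonal element are elements of the small group. *)
Lemma monoGL1_split w (M : 'I_n -> 'M[K]_d) :
  glval w = monomial_block 1 M -> exists2 f, w = monoGL 1 f & forall i, glval (f i) = M i.
Proof.
move=> Dw; have uM i : M i \in unitmx.
  have:= glFix_unit w; rewrite Dw unitmxE det_monomial_block1 unitfE => nz.
  by rewrite unitmxE unitfE; apply: (prodf_neq0 _ _ nz).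
have fM i : steinberg eta q (M i) = M i.
  have:= glFix_fixed w; rewrite Dw steinberg_monomial_block ?card_Fq_gt0 //.
    by move/monomial_block_injr.
  exact: pchar_nat_q iota.
have MP i : (M i \in unitmx) && (iter 1.-1.+1 (steinberg eta q (n := d)) (M i) == M i).
  by rewrite uM /= fM eqxx.
by exists (fun i => GLFix iota (MP i)) => //; apply: val_inj.
Qed.

End Mono.

(** * A polynomial which isolates one block *)

Section BlockIdempotent.

Variables (K : fieldType) (om : K).

(** This is [e * (t - 1) + 1] where [e] is the value at [s] of the polynomial
    which is [1] at [om] and [0] at [1] and [om^-1].  For block diagonal [s] with
    these three scalars as blocks, [e] is the projection onto the blocks where
    [s] is [om], and the result agrees with [t] there and with [1] elsewhere. *)
Definition blockPoly N (s t : 'M[K]_N) : 'M[K]_N :=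
  ((om - 1) * (om - om^-1))^-1 *: ((- 1) *: 1%:M + s) *m ((- om^-1) *: 1%:M + s)
    *m ((- 1) *: 1%:M + t) + 1%:M.

Lemma blockPolyJ N (g s t : 'M[K]_N) : g \in unitmx ->
  blockPoly (invmx g *m (s *m g)) (invmx g *m (t *m g))
    = invmx g *m (blockPoly s t *m g).
Proof.
move=> ug; rewrite /blockPoly [in RHS]mulmxDl [in RHS]mulmxDr [in RHS]mul1mx.
rewrite mulVmx //; congr (_ + _).
have J c (u : 'M[K]_N) :
    c *: 1%:M + invmx g *m (u *m g) = invmx g *m ((c *: 1%:M + u) *m g).
  by rewrite mulmxDl mulmxDr -scalemxAl -scalemxAr mul1mx mulVmx.
by rewrite !J scalemxAr scalemxAl -!mulmxA !(mulKVmx ug).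
Qed.

Lemma blockPoly_block d n (s t : 'I_d -> 'M[K]_n) :
  blockPoly (monomial_block 1 s) (monomial_block 1 t)
    = monomial_block 1 (fun i => blockPoly (s i) (t i)).
Proof.
rewrite /blockPoly -(monomial_block1 K d n) -!monomial_block_lin.
have Z c (f : 'I_d -> 'M[K]_n) :
    c *: monomial_block 1 f = monomial_block 1 (fun i => c *: f i).
  rewrite -[LHS]addr0.
  have -> : 0 = monomial_block 1 (fun=> 0) :> 'M[K]_(d * n).
    by rewrite /monomial_block big1 // => i _; apply: tensmx0.
  by rewrite -monomial_block_lin; apply: eq_monomial_block => i; rewrite addr0.
rewrite Z !monomial_blockM !mulg1 -[X in X + _]scale1r -monomial_block_lin.
by apply: eq_monomial_block => i; rewrite !perm1 scale1r.
Qed.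

Lemma blockPoly1r N (s : 'M[K]_N) : blockPoly s 1%:M = 1%:M.
Proof. by rewrite /blockPoly scaleN1r addNr mulmx0 add0r. Qed.

Lemma blockPoly_om N (t : 'M[K]_N) (om1 : om != 1) (omV : om != om^-1) :
  blockPoly om%:M t = t.
Proof.
rewrite /blockPoly; have sc c : c *: 1%:M + om%:M = (c + om)%:M :> 'M[K]_N.
  by rewrite scalemx1 -raddfD.
rewrite !sc -!scalemxAl mul_scalar_mx -scalemxAl mul_scalar_mx !scalerA.
rewrite -mulrA ![- _ + om]addrC mulVf ?mulf_neq0 ?subr_eq0 //.
by rewrite scale1r scaleN1r addrC addrA subrr add0r.
Qed.

Lemma blockPoly_omV N (t : 'M[K]_N) : blockPoly (om^-1)%:M t = 1%:M.
Proof.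
rewrite /blockPoly; have -> : - om^-1 *: 1%:M + (om^-1)%:M = 0 :> 'M[K]_N.
  by rewrite scalemx1 -raddfD /= addNr raddf0.
by rewrite mulmx0 mul0mx add0r.
Qed.

End BlockIdempotent.

(** * The normalizer of the determinant one part of a wreath product *)

Section Wreath.

Variables (Fq : finFieldType) (K : closedFieldType) (iota : {rmorphism Fq -> K}).
Variables (eta : int) (d n l k0 : nat) (om : K).

Local Notation G := (glFix iota eta 1 d).
Local Notation W := (glFix iota eta 1 (n * d)).

Variables (X : {group G}) (C : {set 'S_n}) (R : {group W}) (z : G).
(* An invariant of the polynomials in z, strong enough to confine those among
   them which are fixed by F and of order dividing #[z] to <[z]>. *)
Variable (P : 'M[K]_d -> Prop).
Implicit Types (s : 'S_n) (f h : 'I_n -> G) (w : W).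

Hypotheses (d_gt0 : (0 < d)%N) (l_prime : prime l) (l_odd : odd l).
Hypothesis RP : forall w : W,
  w \in R <-> exists s f, [/\ s \in C, forall i, f i \in X & w = monoGL s f].
Hypothesis lR : (l.-group R)%g.
Hypothesis defZX : ('Z(X) = <[z]>)%g.
Hypothesis derX : ([~: X, X] \subset 'Z(X))%g.
Hypothesis X_SL : (X \subset <[z]> * slFix iota eta d)%g.
Hypotheses (om_prim : l.-primitive_root om) (zk0 : glval (z ^+ k0)%g = om%:M).
Hypothesis P1 : P 1%:M.
Hypothesis Plin : forall c A B, P A -> P B -> P (c *: A + B).
Hypothesis Pmul : forall A B, P A -> P B -> P (A *m B).
Hypothesis Pz : P (glval z).
Hypothesis Pfix : forall x : G, P (glval x) -> (x ^+ #[z] = 1)%g -> x \in <[z]>%g.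
Hypotheses (n_gt2 : (2 < n)%N) (n_z : (3 < n)%N || (#[z]%g != 3%N)).

Local Notation SL := (slFix iota eta (n * d)).
Local Notation S := (R :&: SL)%g.

Let l_gt2 : (2 < l)%N.
Proof. by case: l l_prime l_odd => [|[|[|]]]. Qed.

Let X_z : z \in X.
Proof. by apply: (subsetP (center_sub X)); rewrite defZX cycle_id. Qed.

Let z_cent (u b : G) : u \in <[z]>%g -> b \in X -> commute u b.
Proof. by rewrite -defZX => /centerP[_ cu] /cu. Qed.

Let ZX (u : G) : u \in <[z]>%g -> u \in X.
Proof. by rewrite -defZX; apply: (subsetP (center_sub X)). Qed.

Let om_neq1 : om != 1.
Proof.
by rewrite -[om]expr1 -(prim_order_dvd om_prim) gtnNdvd // prime_gt1.
Qed.

Let om_neqV : om != om^-1.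
Proof.
have om0 : om != 0 by rewrite (prim_root_eq0 om_prim) -lt0n prime_gt0.
rewrite -(inj_eq (mulfI om0)) mulfV // -expr2 -(prim_order_dvd om_prim).
by rewrite gtnNdvd.
Qed.

Let z_neq1 : z != 1%g.
Proof.
apply: contraNneq om_neq1 => z1; move: zk0; rewrite z1 expg1n => /matrixP.
by move=> /(_ (Ordinal d_gt0) (Ordinal d_gt0)); rewrite !mxE eqxx !mulr1n => <-.
Qed.

Let memR s f : s \in C -> (forall i, f i \in X) -> monoGL s f \in R.
Proof. by move=> Cs Xf; apply/RP; exists s, f. Qed.

Let RE s f : monoGL s f \in R -> s \in C /\ forall i, f i \in X.
Proof. by move/RP=> [s' [f' [Cs Xf /(monoGL_inj d_gt0)[-> ff]]]]; split=> // i; rewrite ff. Qed.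

Let C1 : 1%g \in C.
Proof. by have:= group1 R; rewrite -monoGL1 => /RE[]. Qed.

Let R_odd (w : W) : w \in R -> odd #[w]%g.
Proof.
move=> /(mem_p_elt lR); rewrite /p_elt => lw.
have [k ->] := p_natP lw.
by rewrite oddX l_odd orbT.
Qed.

(** Taking permutation parts is an antihomomorphism on [R], whose elements have
    odd order. *)
Let C_odd s f : monoGL s f \in R -> exists2 r, odd r & (s ^+ r = 1)%g.
Proof.
move=> Rw; exists #[monoGL s f]%g; first exact: R_odd.
have pw r : exists h, (monoGL s f ^+ r = monoGL (s ^+ r) h)%g.
  elim: r => [|r [h Dh]]; first by exists (fun=> 1%g); rewrite !expg0 monoGL1.
  by exists (fun i => f ((s ^+ r)%g i) * h i)%g; rewrite expgS Dh monoGLM -expgSr.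
have [h] := pw #[monoGL s f]%g.
by rewrite expg_order -monoGL1 => /esym/(monoGL_inj d_gt0)[].
Qed.

(** The determinant has order dividing both [2] and an odd number. *)
Let det_perm s : s \in C -> \det (glval (monoGL s (fun=> 1%g : G))) = 1.
Proof.
move=> Cs; set w := monoGL _ _.
have Rw : w \in R by apply: memR => // i; apply: group1.
have dX r : \det (glval (w ^+ r)%g) = \det (glval w) ^+ r.
  by elim: r => [|r IHr]; rewrite ?det1 // expgS exprS det_mulmx IHr.
have d2 : \det (glval w) ^+ 2 = 1 by apply: det_monomial_block_perm_sqr.
have: \det (glval w) ^+ #[w]%g = 1 by rewrite -dX expg_order det1.
rewrite -(odd_double_half #[w]%g) R_odd // exprD -mul2n exprM d2 expr1n mulr1.
by rewrite expr1.
Qed.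

Let det_monoGL s f : s \in C ->
  \det (glval (monoGL s f)) = \prod_i \det (glval (f i)).
Proof. by move=> Cs; rewrite monoGLE det_mulmx det_perm // mul1r det_monoGL1. Qed.

(** The determinants of [z] and [z^-1] cancel, so these diagonal matrices have
    determinant one whatever the determinant of [z] is. *)
Definition zpair (i k : 'I_n) : 'I_n -> G :=
  fun j => if j == i then z else if j == k then (z^-1)%g else 1%g.

Let zpair_z i k j : zpair i k j \in <[z]>%g.
Proof.
by rewrite /zpair; do 2?case: ifP => _; rewrite ?groupV ?group1 ?cycle_id.
Qed.

Let zpair_S i k : k != i -> monoGL 1 (zpair i k) \in S.
Proof.
move=> nki; rewrite inE memR // => [|j]; last exact/ZX/zpair_z.
rewrite inE det_monoGL1 (bigD1 i) //= (bigD1 k) //= /zpair !eqxx (negPf nki).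
rewrite big1 => [|j /andP[/negPf-> /negPf->]]; last exact: det1.
by rewrite mulr1 -det_mulmx -glvalM mulgV det1.
Qed.

(** Defined inside the group [S] alone, hence stable under the normalizer of
    [S]. *)
Let Q := [set s in S | [forall x in S, (s * s ^ x == s ^ x * s)%g]].

Let QP w : reflect (w \in S /\ forall x, x \in S -> commute w (w ^ x)) (w \in Q).
Proof.
rewrite [w \in Q]in_set; apply: (iffP andP) => [[-> /forall_inP c]|[-> c]]; split=> //.
  by move=> x /c/eqP.
by apply/forall_inP=> x /c/eqP.
Qed.

Let perm_avoid (i j k : 'I_n) : (3 < n)%N -> exists m, [/\ m != i, m != j & m != k].
Proof.
move=> n4; have: (0 < #|~: [set i; j; k]|)%N.
  rewrite cardsCs setCK card_ord subn_gt0; apply: leq_trans n4.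
  by rewrite ltnS setUC cardsU1 cards2; case: (k \notin _); case: (i != j).
by case/card_gt0P=> m; rewrite !inE !negb_or -andbA => /and3P[]; exists m.
Qed.

(** Suppose that [w] in [Q] has permutation part [s] moving [j].  Commuting with
    the conjugate of [w] by a diagonal [t] with central entries [h i] means that
    [h (s (s j)) * h j = h (s j) ^+ 2].  Since [s] has odd order, [j],
    [s j] and [s (s j)] are distinct.  With a fourth index [k], the entries [z] at
    [j] and [z^-1] at [k] violate the equation; with three indices only, the
    entries [z] at [j] and [z^-1] at [s j] force [z ^+ 3 = 1]. *)
Lemma Q_diag s f : monoGL s f \in Q -> s = 1%g.
Proof.
case/QP=> Sw cw; have [Rw _] := setIP Sw; have [Cs Xf] := RE Rw.
apply/permP=> j; rewrite perm1; apply/eqP; apply/negPn/negP => nsj.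
have nssj : s (s j) != j.
  apply: contra_neq nsj => ssj; have [r r_odd sr] := C_odd Rw.
  have sE : ((s ^+ r./2.*2) j = j)%g.
    by elim: (r./2) => [|u IHu]; rewrite ?expg0 ?perm1 // doubleS 2!expgSr !permM IHu.
  rewrite -[RHS](perm1 j) -sr -[r]odd_double_half r_odd add1n expgSr permM.
  by rewrite sE.
have nssj' : s (s j) != s j by rewrite (inj_eq perm_inj).
have key i k : k != i ->
    zpair i k (s (s j)) = (zpair i k (s j) * zpair i k (s j) * (zpair i k j)^-1)%g.
  move=> nki; have /(cw _) := zpair_S nki; rewrite monoGLJ1 => cww.
  have zc a b : commute (zpair i k a) (f b) by apply: z_cent.
  pose u a := ((zpair i k (s a))^-1 * zpair i k a)%g.
  have zu a : u a \in <[z]>%g by rewrite groupM ?groupV.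
  (* As t has central entries, w ^ t = w * u with u diagonal, and commuting with
     w ^ t amounts to commuting with u. *)
  have Dw : monoGL s (fun a => (zpair i k (s a))^-1 * f a * zpair i k a)%g
      = (monoGL s f * monoGL 1 u)%g.
    rewrite monoGLM mul1g; apply: eq_monoGL => a; rewrite perm1 /u.
    by rewrite mulgA (commuteV (commute_sym (zc (s a) a))).
  have /(congr1 (mulg (monoGL s f)^-1)%g) : (monoGL 1 u ^ monoGL s f = monoGL 1 u)%g.
    have: (monoGL s f * monoGL 1 u * monoGL s f = monoGL s f * (monoGL s f * monoGL 1 u))%g.
      by rewrite -Dw.
    by rewrite -mulgA => /mulgI; rewrite conjgE => ->; rewrite mulKg.
  move=> /mulgI; rewrite monoGL1J => /(monoGL_inj d_gt0)[_ /(_ j)].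
  rewrite conjgE (z_cent (zu _)) // mulKg /u => E.
  have := zpair_z i k j; have := zpair_z i k (s j); have := zpair_z i k (s (s j)).
  move: E; set x := zpair i k (s (s j)); set y := zpair i k (s j); set v := zpair i k j.
  move=> E zx zy zv.
  have cz a b : a \in <[z]>%g -> b \in <[z]>%g -> commute a b.
    by move=> za zb; apply: z_cent => //; apply: ZX.
  have E' : y = (x * (y^-1 * v))%g by rewrite -E mulKVg.
  apply: (mulIg v); rewrite mulgKV {1}E' -[RHS]mulgA.
  by rewrite (cz (y^-1 * v)%g y) ?groupM ?groupV // mulKVg.
have [n4|n4] := boolP (3 < n)%N.
  have [k [nkj nksj nkssj]] := perm_avoid j (s j) (s (s j)) n4.
  have := key j k nkj; rewrite /zpair eqxx (negPf nsj) (negPf nssj).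
  rewrite !(eq_sym _ k) (negPf nksj) (negPf nkssj) !mul1g => /esym/eqP.
  by rewrite eq_invg1 (negPf z_neq1).
have := key j (s j) nsj; rewrite /zpair !eqxx (negPf nsj) (negPf nssj) (negPf nssj').
move: n_z; rewrite (negPf n4) /= => zn3 /esym E.
have : (z^-1 ^+ 3 == 1)%g by rewrite 2!expgSr expg1 E.
rewrite expgVn eq_invg1 => z3; move: z3.
rewrite -order_dvdn dvdn_divisors // !inE order_eq1 (negPf z_neq1).
by rewrite (negPf zn3).
Qed.

Let mono1_conj s f h : (forall j, h j \in <[z]>%g) -> (forall j, f j \in X) ->
  (monoGL 1 h ^ monoGL s f = monoGL 1 (fun j => h (s j)))%g.
Proof.
move=> zh Xf; rewrite monoGL1J; apply: eq_monoGL => j.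
by rewrite conjgE (z_cent (zh _)) // mulKg.
Qed.

Let mono1_commute f h :
  (forall j, commute (f j) (h j)) -> commute (monoGL 1 f) (monoGL 1 h).
Proof. by move=> c; rewrite /commute !monoGL1M; apply: eq_monoGL => j; apply: c. Qed.

Let zdiag_cent h w : (forall j, h j \in <[z]>%g) -> w \in Q -> commute (monoGL 1 h) w.
Proof.
move=> zh Qw; have /QP[/setIP[/RP[s [f [Cs Xf Dw]]] _] _] := Qw.
rewrite Dw in Qw *; rewrite (Q_diag Qw); apply: mono1_commute => j.
exact: z_cent.
Qed.

Let zpair_Q i k : k != i -> monoGL 1 (zpair i k) \in Q.
Proof.
move=> nki; apply/QP; split=> [|x /setIP[/RP[s [f [Cs Xf ->]]] _]].
  exact: zpair_S.
rewrite mono1_conj; [|exact: zpair_z|by []].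
by apply: mono1_commute => j; apply: z_cent (zpair_z _ _ _) (ZX (zpair_z _ _ _)).
Qed.

Definition place (i : 'I_n) (e : G) : 'I_n -> G :=
  fun j => if j == i then e else 1%g.

Let place_X i e j : e \in X -> place i e j \in X.
Proof. by rewrite /place; case: ifP. Qed.

(** [X] is abelian modulo its centre, so an element of [X] commutes with all its
    [X]-conjugates; copies of it in different blocks commute in any case. *)
Let place_Q i e : e \in X -> \det (glval e) = 1 -> monoGL 1 (place i e) \in Q.
Proof.
move=> Xe de; have Xp j := place_X i j Xe.
apply/QP; split=> [|x /setIP[/RP[s [f [Cs Xf ->]]] _]].
  rewrite inE memR // inE det_monoGL1 (bigD1 i) //= {1}/place eqxx de.
  by rewrite big1 ?mulr1 // => j /negPf nj; rewrite /place nj det1.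
rewrite monoGL1J; apply: mono1_commute => j; rewrite /place.
case: ifP => _; last by apply: commute_sym; apply: commute1.
case: ifP => _; last by rewrite conj1g; apply: commute1.
rewrite -(mulKVg e (e ^ f j)%g) -commgEl; apply: commuteM => //.
apply: commute_sym; apply: z_cent => //.
by rewrite -defZX (subsetP derX) // mem_commg.
Qed.

(** Commuting with the matrices [zpair] excludes a nontrivial permutation part;
    commuting with the elements of determinant one of [X] in a single block puts
    that entry in the centre of [X], because [z] and these elements generate
    [X]. *)
Let cent_Q w : w \in S -> (forall v, v \in Q -> commute w v) ->
  exists2 h, forall j, h j \in <[z]>%g & w = monoGL 1 h.
Proof.
case/setIP=> /RP[s [f [Cs Xf ->]]] _ cw; have s1 : s = 1%g.
  apply/permP=> j; rewrite perm1; apply/eqP; apply/negPn/negP => nsj.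
  have [k [nkj nksj]] : exists k, [/\ k != j & k != s j].
    have: (0 < #|~: [set j; s j]|)%N.
      rewrite cardsCs setCK card_ord subn_gt0; apply: leq_ltn_trans n_gt2.
      by rewrite cards2; case: (_ != _).
    by case/card_gt0P=> k; rewrite !inE negb_or => /andP[]; exists k.
  have /commute_sym/commgP/conjg_fixP := cw _ (zpair_Q nkj).
  rewrite mono1_conj //.
  move=> /(monoGL_inj d_gt0)[_ /(_ j)] /esym/eqP.
  by rewrite /zpair eqxx (negPf nsj) eq_sym (eq_sym _ k) (negPf nksj) eq_sym (negPf z_neq1).
exists f; last by rewrite s1.
move=> i; rewrite -defZX; apply/centerP; split=> // b Xb.
have /mulsgP[u e zu SLe Db] := subsetP X_SL b Xb.
have de : \det (glval e) = 1 by move: SLe; rewrite inE => /eqP.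
have Xe : e \in X by rewrite -(groupMl _ (ZX zu)) -Db.
rewrite Db; apply: commuteM; first by apply: commute_sym; apply: z_cent.
have := cw _ (place_Q i Xe de); rewrite s1 /commute !monoGL1M.
by move=> /(monoGL_inj d_gt0)[_ /(_ i)]; rewrite /place eqxx.
Qed.

(** The determinant of any element of [R] is a power of the determinant of [z],
    which is also the determinant of [place i0 z]. *)
Let R_decomp i0 w : w \in R ->
  exists r v, v \in S /\ w = (monoGL 1 (place i0 z) ^+ r * v)%g.
Proof.
have dX (N : nat) (x : glFix iota eta 1 N) r :
    \det (glval (x ^+ r)%g) = \det (glval x) ^+ r.
  by elim: r => [|r IHr]; rewrite ?det1 // expgS exprS det_mulmx IHr.
have dz : \det (glval (monoGL 1 (place i0 z))) = \det (glval z).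
  rewrite det_monoGL1 (bigD1 i0) //= {1}/place eqxx big1 ?mulr1 // => j /negPf nj.
  by rewrite /place nj det1.
move=> Rw; have Rz : monoGL 1 (place i0 z) \in R.
  by apply: memR => // j; apply: place_X.
have [r Dr] : exists r, \det (glval w) = \det (glval z) ^+ r.
  have /RP[s [f [Cs Xf ->]]] := Rw; rewrite det_monoGL //.
  apply: (big_ind (fun y => exists r, y = \det (glval z) ^+ r)) => [|x y|i _].
  - by exists 0%N.
  - by move=> [r1 ->] [r2 ->]; exists (r1 + r2)%N; rewrite exprD.
  have /mulsgP[u e /cycleP[r ->] SLe ->] := subsetP X_SL _ (Xf i).
  exists r; rewrite det_mulmx dX; move: SLe; rewrite inE => /eqP ->.
  by rewrite mulr1.
exists r, ((monoGL 1 (place i0 z) ^+ r)^-1 * w)%g; rewrite mulKVg; split=> //.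
rewrite inE groupM ?groupV ?groupX //= inE det_mulmx glvalV det_inv dX dz -Dr.
by rewrite mulVf // -unitfE -unitmxE glFix_unit.
Qed.

Lemma wreath_sub_SL : \det (glval z) = 1 -> R \subset SL.
Proof.
move=> dz; have i0 : 'I_n := Ordinal (ltnW (ltnW n_gt2)).
apply/subsetP => w /(R_decomp i0)[r [v [/setIP[_ SLv] ->]]].
rewrite groupM ?groupX // inE det_monoGL1 big1 // => j _.
by rewrite /place; case: ifP => // _; apply: det1.
Qed.

(** By [R_decomp] only [w0 = place i0 z] has to be conjugated into [R].  It is a
    polynomial in the element [t] of the centralizer of [Q], and [t ^ g] again
    centralizes [Q]. *)
Lemma norm_SL_wreath : 'N(S)%g \subset 'N(R)%g.
Proof.
have [i0 [i1 ni]] : exists i0 i1 : 'I_n, i1 != i0.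
  by exists (Ordinal (ltn_trans (ltn0Sn 1) n_gt2)), (Ordinal (ltn_trans (ltnSn 1) n_gt2)).
apply/subsetP => g Ng; rewrite inE; apply/subsetP => _ /imsetP[w Rw ->].
have SJ v : v \in S -> (v ^ g)%g \in S by rewrite memJ_norm.
have SVJ v : v \in S -> (v ^ g^-1)%g \in S by rewrite memJ_norm ?groupV.
have QVJ v : v \in Q -> (v ^ g^-1)%g \in Q.
  case/QP=> Sv cv; apply/QP; split=> [|x Sx]; first exact: SVJ.
  have := cv _ (SJ _ Sx); rewrite /commute => /(congr1 (conjg^~ g^-1)%g).
  by rewrite /= (conjMg v) (conjMg (v ^ (x ^ g))%g) (conjJg v) conjgK.
have [r [v [Sv ->]]] := R_decomp i0 Rw.
rewrite conjMg conjXg groupM ?groupX //; last by have /setIP[] := SJ v Sv.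
set w0 := monoGL 1 _; set t := monoGL 1 (zpair i0 i1).
have [h zh Dt] : exists2 h, forall j, h j \in <[z]>%g & (t ^ g)%g = monoGL 1 h.
  apply: cent_Q => [|q Qq]; first by apply/SJ/zpair_S.
  have /(congr1 (conjg^~ g)) := zdiag_cent (zpair_z i0 i1) (QVJ q Qq).
  by rewrite /= -/t (conjMg t) (conjMg (q ^ g^-1)%g) conjgKV.
have Dw0 : glval w0 = blockPoly om (glval (t ^+ k0)%g) (glval t).
  rewrite /t monoGL1X blockPoly_block; apply: eq_monomial_block => j.
  rewrite /place /zpair; case: ifP => _; first by rewrite zk0 blockPoly_om.
  case: ifP => _; last by rewrite blockPoly1r.
  have -> : glval (z^-1 ^+ k0)%g = (om^-1)%:M.
    by rewrite expgVn -invmx_scalar -zk0.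
  by rewrite blockPoly_omV.
have Dw0g : glval (w0 ^ g)%g
    = monomial_block 1 (fun j => blockPoly om (glval (h j ^+ k0)%g) (glval (h j))).
  rewrite -blockPoly_block conjgE glvalM glvalV glvalM Dw0.
  rewrite -blockPolyJ ?glFix_unit // -!glvalM -!glvalV -!glvalM -!conjgE.
  by rewrite conjXg Dt monoGL1X.
have [f Dg Df] := monoGL1_split Dw0g.
rewrite Dg; apply: memR => // j; apply/ZX/Pfix.
  have PX x : x \in <[z]>%g -> P (glval x).
    case/cycleP=> u ->; elim: u => [|u IHu]; first by rewrite expg0.
    by rewrite expgS; apply: Pmul.
  have P0 c (x : 'M[K]_d) : P x -> P (c *: 1%:M + x) by apply: Plin.
  rewrite Df /blockPoly -scalemxAl -scalemxAl; apply: Plin => //.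
  by do 2?apply: Pmul; apply: P0; apply: PX; rewrite ?groupX.
have: ((w0 ^ g) ^+ #[z] = 1)%g.
  rewrite -conjXg monoGL1X -[RHS](conj1g g) -monoGL1; congr (_ ^ g)%g.
  apply: eq_monoGL => i; rewrite /place; case: ifP => _; last exact: expg1n.
  exact: expg_order.
by rewrite Dg monoGL1X -monoGL1 => /(monoGL_inj d_gt0)[_ /(_ j)].
Qed.

End Wreath.

(** * Tensor products *)

Section TensorProducts.

Variable K : fieldType.

Lemma tensmx11 m n : (1%:M : 'M[K]_m) *t (1%:M : 'M[K]_n) = 1%:M.
Proof.
apply/matrixP => x y; case: (mxtens_indexP x) => i a.
case: (mxtens_indexP y) => j b; rewrite tensmxE !mxE.
rewrite (inj_eq (can_inj (@mxtens_indexK m n))) xpair_eqE.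
by case: eqP; rewrite (mul1r, mul0r).
Qed.

Lemma tensmxZ m n (c e : K) (A : 'M_m) (B : 'M_n) :
  (c *: A) *t (e *: B) = (c * e) *: (A *t B).
Proof. by apply/matrixP => x y; rewrite !mxE mulrACA. Qed.

Lemma tensmx_unitmx m n (A : 'M[K]_m) (B : 'M[K]_n) :
  A \in unitmx -> B \in unitmx -> A *t B \in unitmx.
Proof.
move=> uA uB; have /mulmx1_unit[//] : (A *t B) *m (invmx A *t invmx B) = 1%:M.
by rewrite tensmx_mul !mulmxV // tensmx11.
Qed.

Lemma invmx_tens m n (A : 'M[K]_m) (B : 'M[K]_n) :
  A \in unitmx -> B \in unitmx -> invmx (A *t B) = invmx A *t invmx B.
Proof.
move=> uA uB; apply: (can_inj (mulKmx (tensmx_unitmx uA uB))).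
by rewrite mulmxV ?tensmx_unitmx // tensmx_mul !mulmxV // tensmx11.
Qed.

(** For [1%:M *t D] this is the determinant of a block diagonal matrix; the other
    factor is brought to this form by exchanging the tensor factors, which
    permutes rows and columns in the same way. *)
Lemma det_tensmx m n (A : 'M[K]_m) (B : 'M[K]_n) :
  \det (A *t B) = \det A ^+ n * \det B ^+ m.
Proof.
have det1B p r (D : 'M[K]_r) : \det ((1%:M : 'M_p) *t D) = \det D ^+ p.
  have -> : (1%:M : 'M_p) *t D = monomial_block 1 (fun=> D).
    apply/matrixP => x y; case: (mxtens_indexP x) => i a.
    case: (mxtens_indexP y) => j b; rewrite tensmxE monomial_blockE perm1 mxE.
    by case: eqP; rewrite (mul1r, mul0r).
  by rewrite det_monomial_block1 prodr_const card_ord.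
rewrite tensmx_decr det_mulmx det1B -[in RHS](det1B n); congr (_ * _).
pose sw (x : 'I_(m * n)) : 'I_(m * n) := cast_ord (mulnC n m)
  (mxtens_index ((mxtens_unindex x).2, (mxtens_unindex x).1)).
have sw_inj : injective sw.
  move=> x y /cast_ord_inj /(can_inj (@mxtens_indexK n m)) e.
  rewrite -[x]mxtens_unindexK -[y]mxtens_unindexK; move: e.
  case: (mxtens_unindex x) => i a; case: (mxtens_unindex y) => j b /= e.
  by case: e => -> ->.
have det_cast N N' (e : N = N') (M : 'M[K]_N) : \det (castmx (e, e) M) = \det M.
  by case: _ / e; rewrite castmx_id.
rewrite -(det_cast _ _ (mulnC n m)); set M := castmx _ _.
have -> : A *t 1%:M = row_perm (perm sw_inj) (col_perm (perm sw_inj) M).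
  apply/matrixP => x y; case: (mxtens_indexP x) => i a.
  case: (mxtens_indexP y) => j b.
  by rewrite !mxE !permE castmxE !cast_ordK !mxtens_indexK /= tensmxE !mxE mulrC.
rewrite row_permE col_permE !det_mulmx !det_perm odd_permV.
by rewrite mulrCA -expr2 sqrr_sign mulr1.
Qed.

Section TensorPower.

Variable l : nat.
Implicit Types M N : nat -> 'M[K]_l.

Lemma eq_tensprod M N g :
  (forall j, (j < g)%N -> M j = N j) -> tensprod M g = tensprod N g.
Proof.
elim: g => //= g IHg eMN; rewrite IHg ?eMN // => j jg.
by apply/eMN/leqW.
Qed.

Lemma tensprod1 g : tensprod (fun=> 1%:M : 'M[K]_l) g = 1%:M.
Proof. by elim: g => //= g ->; apply: tensmx11. Qed.

Lemma tensprodM M N g :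
  tensprod M g *m tensprod N g = tensprod (fun j => M j *m N j) g.
Proof.
elim: g => [|g IHg] /=; first by rewrite mul1mx.
by rewrite [LHS]tensmx_mul IHg.
Qed.

Lemma tensprodZ (c : nat -> K) M g :
  tensprod (fun j => c j *: M j) g = (\prod_(j < g) c j) *: tensprod M g.
Proof.
elim: g => [|g IHg] /=; first by rewrite big_ord0 scale1r.
by rewrite IHg [LHS]tensmxZ big_ord_recr /= mulrC.
Qed.

Lemma tensprod_unit M g : (forall j, M j \in unitmx) -> tensprod M g \in unitmx.
Proof. by move=> uM; elim: g => [|g IHg]; [apply: unitmx1 | apply: tensmx_unitmx]. Qed.

Lemma det_tensprod M g : (forall j, \det (M j) = 1) -> \det (tensprod M g) = 1.
Proof.
move=> dM; elim: g => [|g IHg]; first exact: det1.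
by rewrite [LHS]det_tensmx IHg dM !expr1n mulr1.
Qed.

End TensorPower.

Section SteinbergTensor.

Variables (eta : int) (q : nat).
Hypotheses (qP : [pchar K].-nat q) (q_gt0 : (0 < q)%N).
Local Notation F := (steinberg eta q).

(** The action of [F] on matrices of size one; for [eta] equal to [1]
    or [-1] it is [c ^ (eta * q)]. *)
Definition steinberg_coef (c : K) : K := if eta == 1 then c ^+ q else (c ^+ q)^-1.

Lemma steinberg_tens m n (A : 'M[K]_m) (B : 'M[K]_n) :
  A \in unitmx -> B \in unitmx -> F (A *t B) = F A *t F B.
Proof.
move=> uA uB; have Dfr : frobmx q (A *t B) = frobmx q A *t frobmx q B.
  by apply/matrixP => x y; rewrite !mxE exprMn.
rewrite /steinberg; case: ifP => // _.
by rewrite Dfr invmx_tens ?frobmx_unit // trmx_tens.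
Qed.

Lemma steinberg_scalar n c : F (c%:M : 'M_n) = (steinberg_coef c)%:M.
Proof.
have Dfr : frobmx q (c%:M : 'M_n) = (c ^+ q)%:M.
  apply/matrixP => i j; rewrite !mxE; case: eqP => //= _.
  by rewrite !mulr0n expr0n eqn0Ngt q_gt0.
rewrite /steinberg /steinberg_coef; case: ifP => // _.
by rewrite Dfr invmx_scalar tr_scalar_mx.
Qed.

Lemma iter_steinberg_scalar n i c :
  iter i (@steinberg K eta q n) c%:M = (iter i steinberg_coef c)%:M.
Proof. by elim: i => //= i ->; apply: steinberg_scalar. Qed.

Lemma det_steinberg n (A : 'M[K]_n) : \det A = 1 -> \det (F A) = 1.
Proof.
move=> dA; have dfr : \det (frobmx q A) = 1.
  have frobB : zmod_morphism (fun x : K => x ^+ q).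
    by move=> x y; rewrite exprDn_pchar // exprNn_pchar.
  have frobM : monoid_morphism (fun x : K => x ^+ q).
    by split=> [|x y]; rewrite ?expr1n ?exprMn.
  pose fB := GRing.isZmodMorphism.Build K K (fun x : K => x ^+ q) frobB.
  pose fM := GRing.isMonoidMorphism.Build K K (fun x : K => x ^+ q) frobM.
  pose f : {rmorphism K -> K} := HB.pack (fun x : K => x ^+ q) fB fM.
  by have := det_map_mx f A; rewrite dA rmorph1.
by rewrite /steinberg; case: ifP => // _; rewrite det_tr det_inv dfr invr1.
Qed.

End SteinbergTensor.

End TensorProducts.

(** * The twisted diagonal embedding *)

Section Twist.

Variables (Fq : finFieldType) (K : closedFieldType) (iota : {rmorphism Fq -> K}).
Variables (eta : int) (k n : nat) (g1 : 'M[K]_k).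

Local Notation q := #|Fq|.
Local Notation F := (@steinberg K eta q _).
Local Notation H := (glFix iota eta k n).
Local Notation G := (glFix iota eta 1 (k * n)).

Hypotheses (k_gt0 : (0 < k)%N) (g1_det : \det g1 = 1).
Hypothesis g1P : invmx g1 *m steinberg eta q g1 = cyclemx K k.

Let g : 'M[K]_(k * n) := tens (1%:M : 'M_n) g1.
Let q0 : (0 < q)%N := card_Fq_gt0 Fq.
Let qP : [pchar K].-nat q := pchar_nat_q iota.

Let u1 : g1 \in unitmx. Proof. by rewrite unitmxE g1_det unitr1. Qed.
Let ug : g \in unitmx. Proof. by apply: tensmx_unitmx => //; apply: unitmx1. Qed.

Definition conjdiag (f : 'I_k -> 'M[K]_n) : 'M[K]_(k * n) :=
  g *m monomial_block 1 f *m invmx g.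

Lemma eq_conjdiag f h : f =1 h -> conjdiag f = conjdiag h.
Proof. by move=> e; rewrite /conjdiag (eq_monomial_block _ e). Qed.

Lemma conjdiagM f h : conjdiag f *m conjdiag h = conjdiag (fun i => f i *m h i).
Proof.
rewrite /conjdiag !mulmxA mulmxKV // -(mulmxA g) monomial_blockM mulg1.
by congr (_ *m _ *m _); apply: eq_monomial_block => i; rewrite perm1.
Qed.

Lemma conjdiag_lin c f h :
  conjdiag (fun i => c *: f i + h i) = c *: conjdiag f + conjdiag h.
Proof.
by rewrite /conjdiag monomial_block_lin mulmxDr mulmxDl -scalemxAr -scalemxAl.
Qed.

Lemma conjdiag_scalar c : conjdiag (fun=> c%:M) = c%:M.
Proof.
rewrite /conjdiag (_ : monomial_block 1 _ = c%:M); last first.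
  apply/matrixP => x y; case: (mxtens_indexP x) => i a.
  case: (mxtens_indexP y) => j b; rewrite monomial_blockE perm1 !mxE.
  by rewrite (inj_eq (can_inj (@mxtens_indexK k n))) xpair_eqE; case: eqP.
by rewrite scalar_mxC mulmxK.
Qed.

Lemma det_conjdiag f : \det (conjdiag f) = \prod_i \det (f i).
Proof.
rewrite !det_mulmx mulrAC det_inv mulfV ?mul1r ?det_monomial_block1 //.
by rewrite -unitfE -unitmxE.
Qed.

Lemma conjdiag_inj f h : conjdiag f = conjdiag h -> f =1 h.
Proof.
rewrite /conjdiag => /(congr1 (mulmx^~ g)); rewrite !mulmxKV //.
by move=> /(can_inj (mulKmx ug))/monomial_block_injr.
Qed.

Lemma conjdiag_unit f : (forall i, f i \in unitmx) -> conjdiag f \in unitmx.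
Proof. by move=> uf; rewrite !unitmx_mul unitmx_inv ug monomial_block_unit. Qed.

Let sigma : 'S_k := perm (@ordS_inj k).

(** The defining property of [g1], spread over the blocks. *)
Let steinberg_g : F g = g *m monomial_block sigma (fun=> 1%:M).
Proof.
have -> : monomial_block sigma (fun=> 1%:M : 'M[K]_n) = cyclemx K k *t 1%:M.
  apply/matrixP => x y; case: (mxtens_indexP x) => i a.
  case: (mxtens_indexP y) => j b; rewrite tensmxE monomial_blockE permE !mxE.
  by rewrite -[i == _](inj_eq val_inj) /=; case: eqP; rewrite (mul1r, mul0r).
rewrite -g1P [LHS]steinberg_tens ?unitmx1 // steinberg_scalar // /steinberg_coef.
by rewrite [RHS]tensmx_mul mulKVmx // mulmx1 expr1n invr1 if_same.
Qed.

(** Conjugation by [g] turns the blockwise action of [F] into [F] on the blocks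
    followed by a cyclic shift, since [invmx g *m F g] is the cyclic block
    permutation matrix. *)
Lemma steinberg_conjdiag f f' : (forall i, f i \in unitmx) ->
  (forall i, f' (ordS i) = F (f i)) -> F (conjdiag f) = conjdiag f'.
Proof.
move=> uf f'S; have uD := monomial_block_unit 1 uf.
have uF : forall i, F (f i) \in unitmx by move=> i; apply: steinberg_unit.
have FV : F (invmx g) = invmx (F g).
  apply: (can_inj (mulKmx (steinberg_unit eta qP ug))).
  by rewrite mulmxV ?steinberg_unit // -steinbergM ?unitmx_inv // mulmxV // steinberg1.
rewrite !steinbergM ?unitmx_mul ?unitmx_inv ?ug // steinberg_monomial_block //.
rewrite FV; apply: (can_inj (mulmxK (steinberg_unit eta qP ug))).
rewrite mulmxKV ?steinberg_unit // steinberg_g /conjdiag !mulmxA mulmxKV //.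
rewrite -!mulmxA !monomial_blockM mulg1 mul1g; congr (_ *m _).
by apply: eq_monomial_block => i; rewrite permE f'S mul1mx mulmx1.
Qed.

(** The cyclic shift makes each block the image under [F] of the previous one. *)
Lemma conjdiag_fixed f : (forall i, f i \in unitmx) ->
  F (conjdiag f) = conjdiag f -> forall i, f i = iter i F (f (Ordinal k_gt0)).
Proof.
move=> uf fixf; have fS i : f (ordS i) = F (f i).
  pose f' i := F (f (ord_pred i)).
  have := steinberg_conjdiag (f' := f') uf; rewrite fixf.
  move=> /(_ _)/conjdiag_inj -> => [|j]; by rewrite /f' ordSK.
case; elim=> [|i IHi] i_lt /=; first by congr f; apply: val_inj.
rewrite -(IHi (ltnW i_lt)) -fS; congr f; apply: val_inj => /=.
by rewrite modn_small.
Qed.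

Fact twist_subproof (A : H) : let B := conjdiag (fun i => iter i F (glval A)) in
  (B \in unitmx) && (iter 1.-1.+1 F B == B).
Proof.
have uA := glFix_unit A; have uI i : iter i F (glval A) \in unitmx.
  by apply: iter_steinberg_unit.
rewrite /= conjdiag_unit //; apply/eqP/steinberg_conjdiag => // i.
have [ik|ki] := ltnP i.+1 k; first by rewrite /= modn_small.
have Dk : k = i.+1 by apply/eqP; rewrite eqn_leq ki ltn_ord.
have fA : iter k F (glval A) = glval A.
  by rewrite -[in iter k](prednK k_gt0); case: A {uA uI} => A /= /andP[_ /eqP].
rewrite -[RHS]/(iter i.+1 F (glval A)) -{1}Dk fA /=.
by rewrite -Dk modnn.
Qed.

Definition twist (A : H) : G := GLFix iota (twist_subproof A).

Lemma twistM : {in [set: H] &, {morph twist : A B / (A * B)%g}}.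
Proof.
move=> A B _ _; apply: val_inj; rewrite /= conjdiagM; apply: eq_conjdiag => i.
by rewrite iter_steinbergM ?glFix_unit.
Qed.

Canonical twist_morphism := Morphism twistM.

Lemma twist_inj : injective twist.
Proof.
by move=> A B /(congr1 val)/conjdiag_inj/(_ (Ordinal k_gt0))/val_inj.
Qed.

Lemma det_twist (A : H) : \det (glval A) = 1 -> \det (glval (twist A)) = 1.
Proof.
move=> dA; rewrite det_conjdiag big1 // => i _.
by elim: (i : nat) => //= j; apply: det_steinberg.
Qed.

End Twist.

(** * Arithmetic of eta q *)

(** Write [v ^+ l - 1] as [v - 1] times a sum of [l] powers of [v], each congruent
    to [1] modulo [l], so that the sum is divisible by [l]. *)
Lemma dvdz_subX1 (l b : nat) (v : int) :
  (0 < b)%N -> ((l ^ b)%N%:Z %| v - 1)%Z -> ((l ^ b.+1)%N%:Z %| v ^+ l - 1)%Z.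
Proof.
case: b => // b _ lv; have l_v : (l%:Z %| v - 1)%Z.
  by apply: dvdz_trans lv; rewrite expnS PoszM dvdz_mulr.
rewrite subrX1 expnSr PoszM dvdz_mul //.
have -> : \sum_(i < l) v ^+ i = \sum_(i < l) (v ^+ i - 1) + l%:Z.
  by rewrite sumrB sumr_const card_ord natz subrK.
rewrite rpredD //; apply: rpred_sum => i _.
by rewrite subrX1; apply: dvdz_mulr.
Qed.

Lemma dvdz_subXpow (l b s : nat) (v : int) :
  (0 < b)%N -> ((l ^ b)%N%:Z %| v - 1)%Z ->
  ((l ^ (b + s))%N%:Z %| v ^+ (l ^ s) - 1)%Z.
Proof.
move=> b0 lv; elim: s => [|s IHs]; first by rewrite addn0 expn0 expr1.
by rewrite addnS expnSr exprM dvdz_subX1 // ltn_addr.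
Qed.

Section Arithmetic.

Variables (Fq : finFieldType) (K : closedFieldType) (eta : int) (l : nat).
Hypotheses (etaP : eta = 1 \/ eta = -1) (l_prime : prime l).
Hypothesis l_dvd : (l%:Z %| #|Fq|%:Z - eta)%Z.

Local Notation q := #|Fq|.
Local Notation phi := (@steinberg_coef K eta q).
Local Notation a := (aval Fq eta l).

Lemma aval_gt0 : (0 < a)%N.
Proof.
rewrite logn_gt0 mem_primes l_prime -[l]/(`|l%:Z|%N) -dvdzE l_dvd andbT.
rewrite absz_gt0 subr_eq0; have := finNzRing_gt1 Fq.
by case: etaP => ->; case: #|Fq| => [|[|]].
Qed.

Lemma steinberg_coefE c : phi c = c ^ (eta * q%:Z).
Proof.
rewrite /steinberg_coef; case: etaP => -> /=; first by rewrite mul1r.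
by rewrite mulN1r -exprnN.
Qed.

Lemma iter_steinberg_coefE i c : iter i phi c = c ^ ((eta * q%:Z) ^+ i).
Proof.
elim: i => [|i IHi] /=; first by rewrite expr0 expr1z.
by rewrite steinberg_coefE IHi exprz_exp exprSr.
Qed.

Lemma dvdz_aval : ((l ^ a)%N%:Z %| eta * q%:Z - 1)%Z.
Proof.
have -> : eta * q%:Z - 1 = eta * (q%:Z - eta).
  by case: etaP => ->; lia.
apply: dvdz_mull; rewrite dvdzE /= /aval; apply: pfactor_dvdnn.
Qed.

(** [l ^ (a + s)] divides [(eta * q) ^ (l ^ s) - 1].  For [s = alpha] this makes
    [zeta%:M] a fixed point of the [l ^ alpha]-th iterate of [F], and for [s = 0] it makes [F]
    fix the [l]-th roots of unity. *)
Lemma iter_steinberg_coef_fixed s c :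
  c ^+ (l ^ (a + s)) = 1 -> iter (l ^ s) phi c = c.
Proof.
move=> c1; rewrite iter_steinberg_coefE.
have /dvdzP[e De] := dvdz_subXpow s aval_gt0 dvdz_aval.
have c0 : c != 0.
  apply: contraPneq c1 => ->; rewrite expr0n gtn_eqF ?expn_gt0 ?prime_gt0 //=.
  by move/eqP; rewrite eq_sym oner_eq0.
rewrite -(subrK 1 ((eta * q%:Z) ^+ (l ^ s))) De expfzDr // expr1z [e * _]mulrC -exprz_exp.
by rewrite -exprnP c1 exp1rz mul1r.
Qed.

End Arithmetic.

(** * Clock and shift matrices *)

Section ClockShift.

Variables (K : fieldType) (l : nat) (w : K).
Hypotheses (l_gt0 : (0 < l)%N) (wl : w ^+ l = 1).

Definition clockmx : 'M[K]_l := diag_mx (\row_i w ^+ i).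
Local Notation x := clockmx.
Local Notation y := (cyclemx K l).

Let w0 : w != 0.
Proof.
by apply: contraPneq wl => ->; rewrite expr0n gtn_eqF // => /eqP; rewrite eq_sym oner_eq0.
Qed.

Lemma clockmxX r : x ^+ r = diag_mx (\row_i w ^+ (i * r)).
Proof.
elim: r => [|r IHr].
  apply/matrixP => i j; rewrite expr0 !mxE muln0 expr0 //.
rewrite exprS IHr; apply/matrixP => i j; rewrite -mulmxE mul_diag_mx !mxE.
by rewrite mulrnAr -exprD mulnS.
Qed.

Lemma cyclemxX r i j : (y ^+ r) i j = (i == (j + r) %% l :> nat)%N%:R.
Proof.
elim: r i j => [|r IHr] i j.
  by rewrite expr0 !mxE addn0 modn_small ?ltn_ord // -(inj_eq val_inj).
rewrite exprSr -mulmxE mxE (bigD1 (ordS j)) //= big1 => [|k nk].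
  by rewrite IHr !mxE /= eqxx mulr1 addr0 modnDml addSnnS.
rewrite [y _ _]mxE -[_ == _]/(val k == val (ordS j)) (inj_eq val_inj) (negPf nk).
by rewrite mulr0.
Qed.

Lemma clockmx_order : x ^+ l = 1.
Proof.
rewrite clockmxX; apply/matrixP => i j; rewrite !mxE mulnC exprM wl expr1n.
by [].
Qed.

Lemma cyclemx_order : y ^+ l = 1.
Proof.
apply/matrixP => i j; rewrite cyclemxX modnDr modn_small ?ltn_ord // !mxE.
by rewrite -(inj_eq val_inj).
Qed.

(** The Weyl commutation relation, in the form which moves [x] to the left. *)
Lemma shift_clock : y * x = w^-1 *: (x * y).
Proof.
apply/matrixP => i j; rewrite -!mulmxE mul_mx_diag mul_diag_mx !mxE.
case: eqP => [Di|_]; last by rewrite mul0r !mulr0.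
rewrite mul1r mulr1 Di expr_mod // exprS mulKf //.
Qed.

Let sAr (c : K) (A B : 'M[K]_l) : c *: (A * B) = A * (c *: B).
Proof. exact: scalemxAr. Qed.

Let sAl (c : K) (A B : 'M[K]_l) : c *: (A * B) = (c *: A) * B.
Proof. exact: scalemxAl. Qed.

Lemma shift_clockX a b : y ^+ b * x ^+ a = (w^-1) ^+ (b * a) *: (x ^+ a * y ^+ b).
Proof.
have one : forall b, y ^+ b * x = (w^-1) ^+ b *: (x * y ^+ b).
  elim=> [|r IHr]; first by rewrite !expr0 scale1r mul1r mulr1.
  rewrite exprSr -mulrA shift_clock -sAr mulrA IHr -sAl scalerA.
  by rewrite -exprS -mulrA -exprSr.
elim: a => [|a IHa]; first by rewrite muln0 !expr0 scale1r mul1r mulr1.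
rewrite exprS mulrA one -sAl -mulrA IHa -sAr scalerA mulrA.
by rewrite -exprD mulnS.
Qed.

Lemma weylM a b a' b' : (x ^+ a * y ^+ b) * (x ^+ a' * y ^+ b')
  = (w^-1) ^+ (b * a') *: (x ^+ (a + a') * y ^+ (b + b')).
Proof.
rewrite mulrA -(mulrA (x ^+ a)) shift_clockX -sAr -sAl; congr (_ *: _).
by rewrite !exprD !mulrA.
Qed.

Lemma cyclemx_orthogonal : y^T *m y = 1%:M.
Proof.
apply/matrixP => i j; rewrite mxE (bigD1 (ordS i)) //= big1 => [|k nk].
  rewrite !mxE /= eqxx mul1r addr0 -[_ == _]/(val (ordS i) == val (ordS j)).
  by rewrite (inj_eq val_inj) (inj_eq (@ordS_inj _)).
rewrite [y^T _ _]mxE [y _ _]mxE -[_ == _]/(val k == val (ordS i)).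
by rewrite (inj_eq val_inj) (negPf nk) mul0r.
Qed.

Lemma clockmx_unit : x \in unitmx.
Proof.
have /mulmx1_unit[//] : x *m (x ^+ l.-1) = 1%:M.
by rewrite mulmxE -exprS prednK // clockmx_order.
Qed.

Lemma cyclemx_unit : y \in unitmx.
Proof. by have /mulmx1_unit[] := cyclemx_orthogonal. Qed.

Hypothesis l_odd : odd l.

(** The exponents sum to [l * (l - 1) / 2], a multiple of [l] as [l] is odd. *)
Lemma det_clockmx : \det x = 1.
Proof.
rewrite det_diag (eq_bigr (fun i : 'I_l => w ^+ i)) => [|i _]; last by rewrite mxE.
rewrite prodrXr -(big_mkord xpredT (fun i => i)) bin2_sum bin2odd //.
by rewrite exprM wl expr1n.
Qed.

(** Orthogonality gives determinant squared one, and the order [l] is odd. *)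
Lemma det_cyclemx : \det y = 1.
Proof.
have d2 : \det y ^+ 2 = 1 by rewrite expr2 -{1}det_tr -det_mulmx cyclemx_orthogonal det1.
have dX r : \det (y ^+ r) = \det y ^+ r.
  by elim: r => [|r IHr]; rewrite ?det1 // !exprS -mulmxE det_mulmx IHr.
have := dX l; rewrite cyclemx_order det1.
have -> : \det y ^+ l = \det y ^+ (2 * l./2 + 1)%N.
  by congr (_ ^+ _); rewrite -{1}(odd_double_half l) l_odd mul2n addnC.
by rewrite exprD exprM d2 expr1n mul1r expr1.
Qed.

Variables (eta : int) (q : nat).
Hypothesis (qP : [pchar K].-nat q) (q_gt0 : (0 < q)%N).

Lemma steinberg_clockmx : steinberg_coef eta q w = w -> steinberg eta q x = x.
Proof.
have Dfr : frobmx q x = diag_mx (\row_i (w ^+ i) ^+ q).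
  apply/matrixP => i j; rewrite !mxE; case: eqP => // _.
  by rewrite !mulr0n expr0n eqn0Ngt q_gt0.
rewrite /steinberg_coef /steinberg Dfr; case: ifP => _ Ew.
  by congr diag_mx; apply/rowP => i; rewrite !mxE exprAC Ew.
have wq0 : w ^+ q != 0 by rewrite expf_neq0.
have : diag_mx (\row_i (w ^+ i) ^+ q) *m x = 1%:M :> 'M[K]_l.
  rewrite /clockmx mulmx_diag -diag_const_mx; congr diag_mx.
  apply/rowP => i; rewrite !mxE exprAC -exprMn -{2}Ew mulfV ?expr1n //.
move=> inv; have [ud _] := mulmx1_unit inv.
by rewrite -[invmx _]mulmx1 -inv mulKmx // tr_diag_mx.
Qed.

Lemma steinberg_cyclemx : steinberg eta q y = y.
Proof.
have Dfr : frobmx q y = y.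
  apply/matrixP => i j; rewrite !mxE; case: eqP => _; first by rewrite expr1n.
  by rewrite expr0n eqn0Ngt q_gt0.
rewrite /steinberg; case: ifP => // _; rewrite Dfr.
have := mulmx1C cyclemx_orthogonal => inv.
by rewrite -[invmx _]mulmx1 -inv mulKmx ?cyclemx_unit // trmxK.
Qed.

End ClockShift.

(** * The group on one block before twisting *)

Lemma mulmx_scale_comm (K : fieldType) n (u v s s' : K) (A B : 'M[K]_n) :
    u != 0 -> u *: (A *m B) = v *: (B *m A) ->
  (s *: A) *m (s' *: B) = (v / u) *: ((s' *: B) *m (s *: A)).
Proof.
move=> u0 E; rewrite -!scalemxAl -!scalemxAr !scalerA.
have -> : s * s' = s * s' / u * u by rewrite divfK.
by rewrite -scalerA E scalerA; congr (_ *: _); ring.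
Qed.

Section BaseGroup.

Variables (Fq : finFieldType) (K : closedFieldType) (iota : {rmorphism Fq -> K}).
Variables (eta : int) (l m alpha gamma : nat) (zeta : K).
Hypotheses (etaP : eta = 1 \/ eta = -1) (l_prime : prime l) (l_odd : odd l).
Hypothesis l_dvd : (l%:Z %| #|Fq|%:Z - eta)%Z.
Hypothesis m_gt0 : (0 < m)%N.

Local Notation q := #|Fq|.
Local Notation e := (aval Fq eta l + alpha)%N.
Hypothesis zetaP : (l ^ e).-primitive_root zeta.

Local Notation n := (powdim l gamma * m)%N.
Local Notation H := (glFix iota eta (l ^ alpha) n).
Local Notation F := (@steinberg K eta q _).
Local Notation phi := (@steinberg_coef K eta q).
Local Notation om := (zetal Fq eta l alpha zeta).
Local Notation x := (xmx Fq eta l alpha zeta).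
Local Notation y := (ymx K l).
Local Notation R := (R0 iota eta l m alpha gamma zeta).

Let q0 : (0 < q)%N := card_Fq_gt0 Fq.
Let qP : [pchar K].-nat q := pchar_nat_q iota.
Let l_gt0 : (0 < l)%N := prime_gt0 l_prime.
Let e_gt0 : (0 < e)%N.
Proof. by rewrite ltn_addr // aval_gt0. Qed.

Lemma dim_gt0 : (0 < n)%N.
Proof. by rewrite muln_gt0 m_gt0 powdimE expn_gt0 l_gt0. Qed.

Lemma zetal_prim : l.-primitive_root om.
Proof.
have := dvdn_prim_root zetaP (dvdn_exp e_gt0 (dvdnn l)).
by rewrite (_ : (l ^ e %/ l)%N = (l ^ e.-1)%N) // -{1}(prednK e_gt0) expnS mulKn.
Qed.

Let oml : om ^+ l = 1 := prim_expr_order zetal_prim.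

Lemma zeta_fixed i : iter (l ^ alpha) phi (zeta ^+ i) = zeta ^+ i.
Proof.
apply: (@iter_steinberg_coef_fixed Fq K eta l) => //.
by rewrite exprAC (prim_expr_order zetaP) expr1n.
Qed.

Lemma zetal_fixed i : phi (om ^+ i) = om ^+ i.
Proof.
have := @iter_steinberg_coef_fixed Fq K eta l etaP l_prime l_dvd 0 (om ^+ i).
rewrite expn0 addn0; apply; rewrite exprAC -(prednK (aval_gt0 etaP l_prime l_dvd)).
by rewrite expnS exprM oml !expr1n.
Qed.

Fact zetaG_subproof :
  ((zeta%:M : 'M_n) \in unitmx) && (iter (l ^ alpha).-1.+1 F (zeta%:M : 'M_n) == zeta%:M).
Proof.
rewrite prednK ?expn_gt0 ?l_gt0 // iter_steinberg_scalar // -[zeta]expr1 zeta_fixed expr1.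
rewrite eqxx andbT unitmxE det_scalar unitrX // unitfE.
by rewrite (prim_root_eq0 zetaP) -lt0n expn_gt0 l_gt0.
Qed.

Definition zetaG : H := GLFix iota zetaG_subproof.

Lemma glval_zetaGX i : glval (zetaG ^+ i)%g = (zeta ^+ i)%:M.
Proof.
elim: i => [|i IHi]; first by rewrite expr0.
by rewrite expgS glvalM IHi -scalar_mxM -exprS.
Qed.

Lemma zetaG_R0 : zetaG \in R.
Proof. by apply: mem_gen; rewrite inE eqxx. Qed.

Lemma zetaGX_eq1 i : (zetaG ^+ i == 1)%g = (l ^ e %| i)%N.
Proof.
rewrite (prim_order_dvd zetaP) -(inj_eq val_inj) /= glval_zetaGX.
apply/eqP/eqP => [/matrixP/(_ (Ordinal dim_gt0) (Ordinal dim_gt0))|-> //].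
by rewrite !mxE eqxx.
Qed.

(** Up to scalars the generators of [R0] other than [zeta] multiply like vectors
    [(a, b)] of exponents, which gives a normal form for the elements of [R0]. *)
Definition weylmx (a b : nat -> nat) : 'M[K]_n :=
  tens (1%:M : 'M_m) (tensprod (fun j => x ^+ a j * y ^+ b j) gamma).

Lemma weylmxM a b a' b' : weylmx a b *m weylmx a' b'
  = (om^-1) ^+ (\sum_(j < gamma) b j * a' j)
    *: weylmx (fun j => a j + a' j)%N (fun j => b j + b' j)%N.
Proof.
rewrite [LHS]tensmx_mul mulmx1 tensprodM.
rewrite (@eq_tensprod _ _ _ (fun j => (om^-1) ^+ (b j * a' j)
   *: (x ^+ (a j + a' j) * y ^+ (b j + b' j)))) => [|j _]; last exact: weylM.
by rewrite tensprodZ -[X in _ *t X]scale1r [LHS]tensmxZ mulr1 prodrXr.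
Qed.

Lemma weylmx0 : weylmx (fun=> 0%N) (fun=> 0%N) = 1%:M.
Proof.
rewrite /weylmx (@eq_tensprod _ _ _ (fun=> 1%:M)) => [|j _]; last by rewrite mulr1.
by rewrite tensprod1 [LHS]tensmx11.
Qed.

Lemma eq_weylmx a b a' b' :
  (forall j, (j < gamma)%N -> x ^+ a j = x ^+ a' j /\ y ^+ b j = y ^+ b' j) ->
  weylmx a b = weylmx a' b'.
Proof.
by move=> ab; rewrite /weylmx; congr tens; apply: eq_tensprod => j /ab[-> ->].
Qed.

Lemma weylmx_x j : tens (1%:M : 'M_m) (factor gamma x j) = weylmx (fun i => i == j) (fun=> 0%N).
Proof.
by congr tens; apply: eq_tensprod => i _; rewrite mulr1; case: eqP.
Qed.

Lemma weylmx_y j : tens (1%:M : 'M_m) (factor gamma y j) = weylmx (fun=> 0%N) (fun i => i == j).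
Proof.
by congr tens; apply: eq_tensprod => i _; rewrite mul1r; case: eqP.
Qed.

Let ux : x \in unitmx := clockmx_unit l_gt0 oml.
Let uy : y \in unitmx := cyclemx_unit K l.

Let Fx : F x = x.
Proof. by apply: steinberg_clockmx => //; have := zetal_fixed 1; rewrite expr1. Qed.

Let Fy : F y = y.
Proof. exact: steinberg_cyclemx. Qed.

Lemma factor_fixed (B : 'M[K]_l) j : B \in unitmx -> F B = B ->
  let A := tens (1%:M : 'M_m) (factor gamma B j) in
  (A \in unitmx) && (iter (l ^ alpha).-1.+1 F A == A).
Proof.
move=> uB FB /=; set A := tens _ _; have uf : factor gamma B j \in unitmx.
  by apply: tensprod_unit => i; case: ifP; rewrite // unitmx1.
have FA : F A = A.
  rewrite [LHS]steinberg_tens ?unitmx1 // steinberg1 //; congr tensmx.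
  rewrite /factor; elim: (gamma) => [|g IHg] /=; first exact: steinberg1.
  rewrite [LHS]steinberg_tens ?IHg //.
  - by congr tensmx; case: ifP => // _; apply: steinberg1.
  - by case: ifP; rewrite // unitmx1.
  - by apply: tensprod_unit => i; case: ifP; rewrite // unitmx1.
rewrite tensmx_unitmx ?unitmx1 //=.
by elim: (_.-1) => /= [|i /eqP ->]; rewrite FA.
Qed.

Lemma R0_ind (P : H -> Prop) : P 1%g -> (forall A B, P A -> P B -> P (A * B)%g) ->
  P zetaG ->
  (forall A (B : 'M_l) j, glval A = tens (1%:M : 'M_m) (factor gamma B j) ->
    B = x \/ B = y -> P A) ->
  forall A, A \in R -> P A.
Proof.
move=> P1 PM Pz Pxy A /gen_prodgP[r [c c_gen ->]].
apply: (big_ind P) => // i _; have := c_gen i; rewrite inE => /or3P[].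
- by move=> /eqP E; rewrite (_ : c i = zetaG) //; apply: val_inj.
- by case/existsP=> j /eqP/Pxy; apply; left.
by case/existsP=> j /eqP/Pxy; apply; right.
Qed.

Lemma R0_weyl A : A \in R -> exists i a b, glval A = zeta ^+ i *: weylmx a b.
Proof.
have omV : om^-1 = zeta ^+ (l ^ e.-1 * l.-1).
  have om0 : om != 0 by rewrite (prim_root_eq0 zetal_prim) -lt0n.
  rewrite [RHS](exprM zeta) -[zeta ^+ _]/om; apply: (mulfI om0).
  by rewrite mulfV // -exprS (prednK l_gt0) oml.
move: A; apply: R0_ind => [|A B [i [a [b DA]]] [i' [a' [b' DB]]]||A B j DA].
- by exists 0%N, (fun=> 0%N), (fun=> 0%N); rewrite weylmx0 scale1r.
- have := weylmxM a b a' b'; rewrite omV -exprM.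
  move: (l ^ e.-1 * l.-1 * _)%N => r E.
  exists (i + i' + r)%N, (fun j => a j + a' j)%N, (fun j => b j + b' j)%N.
  by rewrite glvalM DA DB -scalemxAl -scalemxAr E !scalerA -!exprD.
- exists 1%N, (fun=> 0%N), (fun=> 0%N).
  by rewrite weylmx0 expr1 scalemx1.
case=> DB; exists 0%N; rewrite DA DB.
  by exists (fun i => i == j), (fun=> 0%N); rewrite weylmx_x scale1r.
by exists (fun=> 0%N), (fun i => i == j); rewrite weylmx_y scale1r.
Qed.

Lemma weylmx_unit a b : weylmx a b \in unitmx.
Proof.
have uX (A : 'M[K]_l) r : A \in unitmx -> A ^+ r \in unitmx.
  by move=> uA; elim: r => [|r IHr]; rewrite ?unitmx1 // exprS -mulmxE unitmx_mul uA.
apply: tensmx_unitmx (unitmx1 _ _); apply: tensprod_unit => j.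
by rewrite -mulmxE unitmx_mul !uX.
Qed.

Lemma weylmxC (a b a' b' : nat -> nat) :
  (om^-1) ^+ (\sum_(j < gamma) b' j * a j) *: (weylmx a b *m weylmx a' b')
  = (om^-1) ^+ (\sum_(j < gamma) b j * a' j) *: (weylmx a' b' *m weylmx a b).
Proof.
rewrite !weylmxM !scalerA; set u := _ ^+ _; set v := _ ^+ _; rewrite [v * u]mulrC.
rewrite (@eq_weylmx (fun j => a j + a' j)%N _ (fun j => a' j + a j)%N
  (fun j => b' j + b j)%N) // => j _.
by rewrite (addnC (a j)) (addnC (b j)).
Qed.

Let om0 : om^-1 != 0.
Proof. by rewrite invr_eq0 (prim_root_eq0 zetal_prim) -lt0n. Qed.

Lemma R0_comm A B : A \in R -> B \in R -> exists c : K, glval [~ A, B]%g = c%:M.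
Proof.
move=> /R0_weyl[i [a [b DA]]] /R0_weyl[i' [a' [b' DB]]].
pose u := (om^-1) ^+ (\sum_(j < gamma) b' j * a j).
pose v := (om^-1) ^+ (\sum_(j < gamma) b j * a' j).
have u0 : u != 0 by rewrite expf_neq0.
exists (v / u); have E : glval (A * B)%g = (v / u) *: glval (B * A)%g.
  by rewrite !glvalM DA DB; apply: mulmx_scale_comm => //; apply: weylmxC.
have -> : [~ A, B]%g = ((B * A)^-1 * (A * B))%g by rewrite invMg commgEl conjgE !mulgA.
rewrite glvalM E -scalemxAr -glvalM mulVg glval1 scalemx1 //.
Qed.

(** Commuting with the generators of clock and shift type at [j] makes the
    exponents [b j] and [a j] divisible by [l], and then the normal form is
    scalar. *)
Lemma R0_center A : A \in R -> (forall B, B \in R -> commute A B) ->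
  exists i, A = (zetaG ^+ i)%g.
Proof.
move=> RA cA; have [i [a [b DA]]] := R0_weyl RA.
have z0 : zeta ^+ i != 0.
  by rewrite expf_neq0 // (prim_root_eq0 zetaP) -lt0n expn_gt0 l_gt0.
have key (B : H) a' b' : B \in R -> glval B = weylmx a' b' ->
    (om^-1) ^+ (\sum_(j < gamma) b' j * a j)
      = (om^-1) ^+ (\sum_(j < gamma) b j * a' j).
  move=> RB DB; have /(congr1 val) := cA B RB.
  rewrite /= DA DB -scalemxAl -scalemxAr => /(scalerI z0) cW.
  have := weylmxC a b a' b'; rewrite cW => /eqP.
  rewrite -subr_eq0 -scalerBl scaler_eq0 subr_eq0 => /orP[/eqP //|W0].
  by case/negP: (unitmx_neq0 dim_gt0 (etrans (unitmx_mul _ _)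
    (introT andP (conj (weylmx_unit a' b') (weylmx_unit a b))))).
have pick (f : nat -> nat) j : (j < gamma)%N -> (\sum_(i < gamma) f i * (i == j :> nat) = f j)%N.
  move=> jg; rewrite (bigD1 (Ordinal jg)) //= eqxx muln1 big1 ?addn0 // => r.
  by rewrite -(inj_eq val_inj) /= => /negPf ->; rewrite muln0.
have omV1 r : (om^-1) ^+ r = 1 -> (l %| r)%N.
  by move/eqP; rewrite exprVn invr_eq1 -(prim_order_dvd zetal_prim).
have b_dvd j : (j < gamma)%N -> (l %| b j)%N.
  move=> jg; pose X : H := GLFix iota (factor_fixed j ux Fx).
  have RX : X \in R.
    apply: mem_gen; rewrite inE; apply/or3P/Or32/existsP.
    by exists (Ordinal jg).
  apply: omV1; have := key X _ _ RX (weylmx_x j); rewrite pick //.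
  by rewrite big1 ?expr0.
have a_dvd j : (j < gamma)%N -> (l %| a j)%N.
  move=> jg; pose Y : H := GLFix iota (factor_fixed j uy Fy).
  have RY : Y \in R.
    apply: mem_gen; rewrite inE; apply/or3P/Or33/existsP.
    by exists (Ordinal jg).
  apply: omV1; have := key Y _ _ RY (weylmx_y j).
  under eq_bigr do rewrite mulnC; rewrite pick // => ->.
  by rewrite big1 ?expr0 // => r _; rewrite muln0.
exists i; apply: val_inj; rewrite /= glval_zetaGX DA.
rewrite (@eq_weylmx _ _ (fun=> 0%N) (fun=> 0%N)) ?weylmx0 ?scalemx1 // => j jg.
have /dvdnP[r ->] := a_dvd j jg; have /dvdnP[t ->] := b_dvd j jg.
by rewrite !(mulnC _ l) !exprM clockmx_order // cyclemx_order !expr1n.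
Qed.

Lemma det_weylmx a b : \det (weylmx a b) = 1.
Proof.
rewrite [LHS]det_tensmx det1 expr1n mulr1 det_tensprod ?expr1n // => j.
have dX (B : 'M[K]_l) r : \det B = 1 -> \det (B ^+ r) = 1.
  move=> dB; elim: r => [|r IHr]; first exact: det1.
  by rewrite exprS -mulmxE det_mulmx dB IHr mulr1.
rewrite -mulmxE det_mulmx !dX ?mulr1 ?det_cyclemx // det_clockmx //.
Qed.

Lemma R0_det A : A \in R -> exists i B, [/\ B \in R, \det (glval B) = 1 & A = (zetaG ^+ i * B)%g].
Proof.
move=> RA; have [i [a [b DA]]] := R0_weyl RA.
exists i, ((zetaG ^+ i)^-1 * A)%g; rewrite mulKVg groupM ?groupV ?groupX ?zetaG_R0 //.
split=> //; rewrite -(det_weylmx a b); congr (\det _).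
apply: (can_inj (mulKmx (glFix_unit (zetaG ^+ i)%g))).
by rewrite -glvalM mulKVg DA glval_zetaGX mul_scalar_mx.
Qed.

End BaseGroup.

(** * The group on one block *)

Section TwistedBase.

Variables (Fq : finFieldType) (K : closedFieldType) (iota : {rmorphism Fq -> K}).
Variables (eta : int) (l m alpha gamma : nat) (zeta : K) (g1 : 'M[K]_(l ^ alpha)).
Hypotheses (etaP : eta = 1 \/ eta = -1) (l_prime : prime l) (l_odd : odd l).
Hypothesis l_dvd : (l%:Z %| #|Fq|%:Z - eta)%Z.
Hypothesis m_gt0 : (0 < m)%N.
Local Notation e := (aval Fq eta l + alpha)%N.
Hypothesis zetaP : (l ^ e).-primitive_root zeta.
Hypotheses (g1_det : \det g1 = 1)
  (g1P : invmx g1 *m steinberg eta #|Fq| g1 = cyclemx K (l ^ alpha)).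

Local Notation q := #|Fq|.
Local Notation n := (powdim l gamma * m)%N.
Local Notation G := (glFix iota eta 1 (basicdim0 l m alpha gamma)).
Local Notation phi := (@steinberg_coef K eta q).
Local Notation om := (zetal Fq eta l alpha zeta).
Local Notation R := (R0 iota eta l m alpha gamma zeta).

Let k_gt0 : (0 < l ^ alpha)%N.
Proof. by rewrite expn_gt0 prime_gt0. Qed.

Let n0 : (0 < n)%N := dim_gt0 gamma l_prime m_gt0.
Let q0 : (0 < q)%N := card_Fq_gt0 Fq.

Local Notation tw := (@twist_morphism Fq K iota eta _ n g1 k_gt0 g1_det g1P).
Local Notation zH := (zetaG iota m gamma etaP l_prime l_dvd zetaP).

Definition blockGroup : {group G} := (tw @* R)%G.
Definition blockz : G := tw zH.

Lemma basic0E : basic0 iota eta m gamma zeta g1 = blockGroup :> {set G}.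
Proof.
apply/setP => b; rewrite inE; apply/exists_inP/morphimP => [[A RA /eqP Db]|[A _ RA ->]].
  by exists A => //; rewrite ?inE //; apply: val_inj.
by exists A.
Qed.

Lemma blockGroupP b : b \in blockGroup -> exists2 A, A \in R & b = tw A.
Proof. by case/morphimP=> A _ RA ->; exists A. Qed.

Lemma mem_blockGroup A : A \in R -> tw A \in blockGroup.
Proof. by move=> RA; apply: mem_morphim; rewrite ?inE. Qed.

Let twM A B : tw (A * B)%g = (tw A * tw B)%g.
Proof. by rewrite morphM ?inE. Qed.

Let twX A i : tw (A ^+ i)%g = (tw A ^+ i)%g.
Proof. by rewrite morphX ?inE. Qed.

Let zHC i A : commute (zH ^+ i)%g A.
Proof.
by apply: val_inj; rewrite /= glval_zetaGX mul_scalar_mx mul_mx_scalar.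
Qed.

Lemma blockz_cent A : commute blockz (tw A).
Proof. by rewrite /commute -!twM; congr (tw _); rewrite -[zH]expg1 zHC. Qed.

Lemma center_blockGroup : 'Z(blockGroup)%g = <[blockz]>%g.
Proof.
apply/eqP; rewrite eqEsubset; apply/andP; split; last first.
  rewrite cycle_subG; apply/centerP; split=> [|b /blockGroupP[A _ ->]].
    exact/mem_blockGroup/zetaG_R0.
  exact: blockz_cent.
apply/subsetP => b /centerP[/blockGroupP[A RA ->] cb].
have [|i ->] := R0_center etaP l_prime l_dvd m_gt0 zetaP RA.
  move=> B RB; apply: (@twist_inj _ _ _ _ _ _ _ k_gt0 g1_det g1P).
  by have := cb _ (mem_blockGroup RB); rewrite /commute -!twM.
by rewrite twX mem_cycle.
Qed.

Lemma der_blockGroup : ([~: blockGroup, blockGroup] \subset 'Z(blockGroup))%g.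
Proof.
rewrite gen_subG; apply/subsetP => _ /imset2P[b1 b2 /blockGroupP[A RA ->] /blockGroupP[B RB ->] ->].
have [c Dc] := R0_comm etaP l_prime l_dvd zetaP RA RB.
rewrite -(morphR tw) ?in_setT //; apply/centerP; split=> [|_ /blockGroupP[D RD ->]].
  by apply: mem_blockGroup; rewrite groupR.
rewrite /commute -!twM; congr (tw _); apply: val_inj.
by rewrite [LHS]glvalM [RHS]glvalM Dc mul_scalar_mx mul_mx_scalar.
Qed.

Lemma blockGroup_SL : (blockGroup \subset <[blockz]> * slFix iota eta _)%g.
Proof.
apply/subsetP => b /blockGroupP[A RA ->].
have [i [B [RB dB ->]]] := R0_det etaP l_prime l_odd l_dvd zetaP RA.
rewrite twM twX mem_mulg ?mem_cycle // inE; apply/eqP.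
exact: det_twist.
Qed.

Lemma order_blockz : #[blockz]%g = (l ^ e)%N.
Proof.
have zX i : (blockz ^+ i == 1)%g = (l ^ e %| i)%N.
  rewrite -twX -(zetaGX_eq1 iota gamma etaP l_prime l_dvd m_gt0 zetaP).
  rewrite -(morph1 tw); apply/eqP/eqP => [/twist_inj//|->] //.
by apply/eqP; rewrite eqn_dvd order_dvdn zX dvdnn -zX expg_order eqxx.
Qed.

Let glval_blockzX i : glval (blockz ^+ i)%g
  = conjdiag g1 (fun j : 'I_(l ^ alpha) => (iter j phi (zeta ^+ i))%:M).
Proof.
rewrite -twX /= glval_zetaGX; apply: eq_conjdiag => j.
exact: iter_steinberg_scalar.
Qed.

Lemma blockzX_scalar : glval (blockz ^+ (l ^ e.-1))%g = om%:M.
Proof.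
rewrite glval_blockzX -(conjdiag_scalar n g1_det); apply: eq_conjdiag => j.
congr (_%:M); rewrite -[zeta ^+ _]/om; elim: (j : nat) => //= i ->.
by have := zetal_fixed etaP l_prime l_dvd zetaP 1; rewrite expr1.
Qed.

(** The algebra in which the polynomials in [blockz] are computed. *)
Definition scalar_blocks (B : 'M[K]_(l ^ alpha * n)) : Prop :=
  exists d : 'I_(l ^ alpha) -> K, B = conjdiag g1 (fun j => (d j)%:M).

Lemma scalar_blocks1 : scalar_blocks 1%:M.
Proof. by exists (fun=> 1); rewrite conjdiag_scalar. Qed.

Lemma scalar_blocks_lin c A B :
  scalar_blocks A -> scalar_blocks B -> scalar_blocks (c *: A + B).
Proof.
move=> [a ->] [b ->]; exists (fun j => c * a j + b j).
rewrite -conjdiag_lin; apply: eq_conjdiag => j.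
by rewrite raddfD /= scale_scalar_mx.
Qed.

Lemma scalar_blocksM A B :
  scalar_blocks A -> scalar_blocks B -> scalar_blocks (A *m B).
Proof.
move=> [a ->] [b ->]; exists (fun j => a j * b j).
by rewrite conjdiagM //; apply: eq_conjdiag => j; rewrite scalar_mxM.
Qed.

Lemma scalar_blocks_z : scalar_blocks (glval blockz).
Proof. by rewrite -[blockz]expg1 glval_blockzX; eexists. Qed.

(** A fixed point of [F] in that algebra is determined by its first block, which
    is a scalar of order dividing that of [zeta], hence a power of [zeta]. *)
Lemma scalar_blocks_fixed (x : G) :
  scalar_blocks (glval x) -> (x ^+ #[blockz] = 1)%g -> x \in <[blockz]>%g.
Proof.
case=> d Dx; rewrite order_blockz => xL.
pose i0 : 'I_n := Ordinal n0.
have dX r : glval (x ^+ r)%g = conjdiag g1 (fun j => (d j ^+ r)%:M).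
  elim: r => [|r IHr].
    by rewrite expg0 glval1 -(conjdiag_scalar n g1_det); apply: eq_conjdiag.
  rewrite expgS glvalM IHr Dx conjdiagM //; apply: eq_conjdiag => j.
  by rewrite -scalar_mxM exprS.
have dL j : d j ^+ (l ^ e) = 1.
  have := dX (l ^ e)%N; rewrite xL glval1 -(conjdiag_scalar n g1_det).
  by move=> /(conjdiag_inj g1_det)/(_ j)/matrixP/(_ i0 i0); rewrite !mxE eqxx.
have ud j : (d j)%:M \in @unitmx K n.
  rewrite unitmxE det_scalar unitrX // unitfE.
  apply: contraPneq (dL j) => ->; rewrite expr0n gtn_eqF ?expn_gt0 ?prime_gt0 //.
  by move/eqP; rewrite eq_sym oner_eq0.
have [r Dr] := prim_rootP zetaP (dL (Ordinal k_gt0)).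
suff -> : x = (blockz ^+ r)%g by apply: mem_cycle.
apply: val_inj; rewrite /= glval_blockzX Dx; apply: eq_conjdiag => j.
rewrite -(iter_steinberg_scalar _ q0) -Dr.
apply: (conjdiag_fixed iota k_gt0 g1_det g1P ud).
by rewrite -Dx glFix_fixed.
Qed.

Lemma det_blockz : (l ^ e %| n)%N -> \det (glval blockz) = 1.
Proof.
move=> Ln; apply: det_twist; rewrite -[zH]expg1 glval_zetaGX expr1 det_scalar.
by apply/eqP; rewrite -(prim_order_dvd zetaP).
Qed.

End TwistedBase.

(** * The basic subgroup *)

Theorem proposition4p19
    (p : nat) (p_prime : prime p)
    (* Fq has q = #|Fq| elements and K is an algebraic closure of Fq *)
    (Fq : finFieldType) (charFq : p \in [pchar Fq])
    (K : closedFieldType) (iota : {rmorphism Fq -> K})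
    (K_alg : forall x : K, algebraicOver iota x)
    (eta : int) (etaP : eta = 1 \/ eta = -1)
    (l : nat) (l_prime : prime l) (l_odd : odd l) (l_neq_p : l != p)
    (l_dvd : (l%:Z %| #|Fq|%:Z - eta)%Z)
    (m alpha gamma : nat) (m_ge1 : (1 <= m)%N)
    (c : seq nat) (c_pos : all (fun n => 0 < n)%N c) (c_neq0 : c <> [::])
    (zeta : K)
    (zetaP : (l ^ (aval Fq eta l + alpha)).-primitive_root zeta)
    (g1 : 'M[K]_(l ^ alpha)) (g1_det : \det g1 = 1)
    (g1P : invmx g1 *m steinberg eta #|Fq| g1 = cyclemx K (l ^ alpha))
    (A : forall n, {group 'S_(l ^ n)})
    (AP : forall n, (0 < n)%N -> regular_elementary_abelian (A n)) :
  let N := basicdim l m alpha gamma c in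
  let GL := [set: glFix iota eta 1 N] in
  let SL := slFix iota eta N in
  let R := basic iota eta m gamma zeta g1 A c in
  radical_lsub l GL R ->
  ~ (l = 3%N /\ aval Fq eta l = 1%N /\
     (logn l m = 0%N /\ alpha = 0%N /\ gamma = 0%N) /\ c = [:: 1%N]) ->
  special_lsub l GL SL R.
Proof.
move=> N GL SL R radR not_excl; have [_ lR defR] := radR.
pose n := seqdim l c; pose d := basicdim0 l m alpha gamma.
have d_gt0 : (0 < d)%N.
  by rewrite muln_gt0 expn_gt0 prime_gt0 // (dim_gt0 gamma l_prime m_ge1).
have [Rg DR] : exists Rg : {group glFix iota eta 1 N}, R = Rg.
  by exists 'O_l('N_GL(R))%G.
have l_gt2 : (2 < l)%N by case: (l) l_prime l_odd => [|[|[|]]].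
have sum_gt0 : (0 < sumn c)%N.
  by case: (c) c_pos c_neq0 => [//|c1 c' /= /andP[c1_gt0 _] _]; rewrite addn_gt0 c1_gt0.
have n_gt2 : (2 < n)%N.
  rewrite /n seqdimE (leq_trans l_gt2) // -{1}[l]expn1 leq_exp2l // ltnW //.
pose X := blockGroup iota m gamma zeta l_prime g1_det g1P.
pose z := blockz iota m gamma etaP l_prime l_dvd zetaP g1_det g1P.
have RP (w : glFix iota eta 1 (n * d)) : w \in Rg <-> exists s f,
    [/\ s \in Aseq A c, forall i, f i \in X & w = monoGL s f].
  rewrite -DR inE; split=> [/exists_inP[s Cs /existsP[f /andP[/forallP Xf /eqP Dw]]]|].
    exists s, f; split=> // [i|]; last exact: val_inj.
    by have := Xf i; rewrite (basic0E _ _ _ _ l_prime g1_det g1P).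
  case=> s [f [Cs Xf ->]]; apply/exists_inP; exists s => //; apply/existsP.
  exists [ffun i => f i]; apply/andP; split.
    by apply/forallP=> i; rewrite ffunE (basic0E _ _ _ _ l_prime g1_det g1P).
  by apply/eqP/eq_monomial_block => i; rewrite ffunE.
suff nS : 'N(R :&: SL)%g = 'N(R)%g by split=> //; rewrite setTI nS -[X in 'O_l(X)%g]setTI.
rewrite DR; apply/eqP; rewrite eqEsubset; apply/andP; split; last first.
  by apply: normsI => //; apply: subset_trans (subsetT _) (normal_norm (slFix_normal iota eta N)).
have lRg : (l.-group Rg)%g by rewrite -DR.
have om_prim := zetal_prim etaP l_prime l_dvd zetaP.
have zX := blockzX_scalar iota m gamma etaP l_prime l_dvd zetaP g1_det g1P.
have defZ := center_blockGroup iota gamma etaP l_prime l_dvd m_ge1 zetaP g1_det g1P.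
have derX := der_blockGroup iota m gamma etaP l_prime l_dvd zetaP g1_det g1P.
have X_SL := blockGroup_SL iota m gamma etaP l_prime l_odd l_dvd zetaP g1_det g1P.
have oz := order_blockz iota gamma etaP l_prime l_dvd m_ge1 zetaP g1_det g1P.
have [n_z|] := boolP ((3 < n)%N || (#[z]%g != 3%N)).
  apply: (norm_SL_wreath d_gt0 l_prime l_odd RP lRg defZ derX X_SL om_prim zX
    (P := scalar_blocks g1)) => //.
  - exact: scalar_blocks1.
  - exact: scalar_blocks_lin.
  - exact: scalar_blocksM.
  - exact: scalar_blocks_z.
  - by move=> x; apply: scalar_blocks_fixed.
(* Three blocks and z of order 3: now R consists of matrices of determinant
   one. *)
rewrite negb_or -leqNgt negbK oz => /andP[n_le3 /eqP L3].
suff sRSL : Rg \subset SL by rewrite (setIidPl sRSL).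
apply: (wreath_sub_SL d_gt0 l_odd RP lRg defZ X_SL n_gt2) => //.
apply: det_blockz => //.
have a_gt0 := aval_gt0 etaP l_prime l_dvd.
have l3 : l = 3%N.
  apply/eqP; rewrite eqn_leq l_gt2 andbT -L3 -{1}[l]expn1 leq_exp2l ?(ltnW l_gt2) //.
  by rewrite ltn_addr.
have c1 : sumn c = 1%N.
  move: n_le3; rewrite /n seqdimE l3 -{2}[3%N]expn1 leq_exp2l // => s1.
  by apply/eqP; rewrite eqn_leq s1.
have c_eq : c = [:: 1%N].
  case: (c) c_pos c_neq0 c1 => [|c1 [|c2 c']] //=; first by rewrite addn0 => _ _ ->.
  move=> /and3P[c1_gt0 c2_gt0 _] _ E.
  by have := leq_add c1_gt0 (ltn_addr (sumn c') c2_gt0); rewrite E.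
have e1 : (aval Fq eta l + alpha = 1)%N.
  by apply/eqP; rewrite -(eqn_exp2l _ _ (ltnW l_gt2)) L3 l3.
rewrite e1 expn1 powdimE; have [g0|] := posnP gamma; last first.
  by move=> g_gt0; rewrite dvdn_mulr // dvdn_exp.
have alpha0 : alpha = 0%N.
  by apply/eqP; rewrite -leqn0 -(leq_add2l 1) addn0 -{2}e1 leq_add2r.
have a1 : aval Fq eta l = 1%N by rewrite -e1 alpha0 addn0.
apply: contraT => nd; case: not_excl; do 4!split=> //.
apply/eqP; rewrite -leqn0 leqNgt logn_gt0 mem_primes l_prime m_ge1 /=.
by move: nd; rewrite g0 mul1n.
Qed.
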